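(* Let $\mathcal{E}$ be a unital commutative C$^\ast$-algebra and $\mathcal{A}$ a closed proper ideal of $\mathcal{E}$ such that the characters of $\mathcal{A}$ can be extended to characters on $\mathcal{E}$. Let $\Phi:\mathcal{E}\to\mathcal{E}$ be an isometric $\ast$-isomorphism with $\Phi(\mathcal{A})=\mathcal{A}$, let $b\in\mathcal{E}$ be invertible, and let $U_{\Phi,b}:\mathcal{A}\to\mathcal{A}$, $U_{\Phi,b}(a)=b\,\Phi(a)$. Assume that for each compact subset $K$ of $\sigma(\mathcal{A})$ there is some $N>0$ such that $$\{\gamma\circ\Phi^n:\ \gamma\in K,\ n\geq N\}\cap K=\varnothing.$$ Then the following are equivalent: (1) $U_{\Phi,b}$ is hypercyclic on $\mathcal{A}$. (2) For every compact set $K\subseteq\sigma(\mathcal{A})$ there exists a strictly increasing sequence $(n_k)_k\subseteq\mathbb{N}$ such that $$\lim_{k\to\infty}\Big(\sup_{\gamma\in K}\prod_{j=0}^{n_k-1}|\gamma(\Phi^{j-n_k}(b))|\Big)=\lim_{k\to\infty}\Big(\sup_{\gamma\in K}\prod_{j=0}^{n_k-1}|\gamma(\Phi^{j}(b))|^{-1}\Big)=0.$$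
   Context: $\sigma(\mathcal{A})$ is the spectrum (character space) of $\mathcal{A}$. For $\gamma\in\sigma(\mathcal{A})$ and $e\in\mathcal{E}$, $\gamma(e)$ means the value at $e$ of the extension of $\gamma$ to a character of $\mathcal{E}$. A bounded operator $T$ on a Banach space $\mathcal{X}$ is hypercyclic if there is $x\in\mathcal{X}$ with $\{T^nx:n\geq 0\}$ dense in $\mathcal{X}$. Standing assumption: the Banach space on which the operator acts (here $\mathcal{A}$) is separable and infinite-dimensional. A supremum of non-negative quantities over the empty set is $0$. *)

(* Defs.v *)
From HB Require Import structures.
From mathcomp Require Import all_boot all_order all_algebra.
From mathcomp Require Import all_classical all_reals all_analysis.
From mathcomp Require Import complex.

Set Implicit Arguments.
Unset Strict Implicit.
Unset Printing Implicit Defensive.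

Import Order.TTheory GRing.Theory Num.Theory.
Import numFieldNormedType.Exports.

Local Open Scope classical_set_scope.
Local Open Scope ring_scope.
Local Open Scope complex_scope.

(* The ring operations are fields of the mixin because the hierarchy has no
   join of normed modules and rings; the canonical [comAlgType] structure on
   [E] is derived from them below. *)
HB.mixin Record isComCStarAlgebra (R : realType) E
    & CompleteNormedModule R[i] E := {
  cmul : E -> E -> E ;
  cone : E ;
  cstar : E -> E ;
  cmulA : associative cmul ;
  cmulC : commutative cmul ;
  cmul1 : left_id cone cmul ;
  cmulDl : left_distributive cmul +%R ;
  cone_neq0 : cone != 0 ;
  cmulZl : forall (c : R[i]) (x y : E), c *: cmul x y = cmul (c *: x) y ;
  cstarK : involutive cstar ;
  cstarD : {morph cstar : x y / x + y} ;
  cstarZ : forall (c : R[i]) (x : E), cstar (c *: x) = c^* *: cstar x ;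
  cstarM : forall x y : E, cstar (cmul x y) = cmul (cstar y) (cstar x) ;
  cnormM : forall x y : E, `|cmul x y| <= `|x| * `|y| ;
  cnorm_star : forall x : E, `|cmul (cstar x) x| = `|x| ^+ 2
}.

#[short(type="comCStarAlgType")]
HB.structure Definition ComCStarAlgebra (R : realType) :=
  {E of CompleteNormedModule R[i] E & isComCStarAlgebra R E}.

#[non_forgetful_inheritance]
HB.instance Definition _ (R : realType) (E : comCStarAlgType R) :=
  GRing.Zmodule_isComNzRing.Build (ComCStarAlgebra.sort E)
    (@cmulA R E) (@cmulC R E) (@cmul1 R E) (@cmulDl R E) (@cone_neq0 R E).

#[non_forgetful_inheritance]
HB.instance Definition _ (R : realType) (E : comCStarAlgType R) :=
  GRing.Lmodule_isLalgebra.Build R[i] (ComCStarAlgebra.sort E) (@cmulZl R E).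

#[non_forgetful_inheritance]
HB.instance Definition _ (R : realType) (E : comCStarAlgType R) :=
  GRing.Lalgebra_isComAlgebra.Build R[i] (ComCStarAlgebra.sort E).

(* *-isomorphisms of [E] onto itself preserving the norm, bundled with their
   inverse. *)
Record isometricStarIso (R : realType) (E : comCStarAlgType R) := {
  siso :> {lrmorphism E -> E} ;
  siso_inv : E -> E ;
  sisoK : cancel siso siso_inv ;
  siso_invK : cancel siso_inv siso ;
  siso_star : {morph siso : x / cstar x} ;
  siso_isometry : forall x : E, `|siso x| = `|x|
}.

Definition siso_pow (R : realType) (E : comCStarAlgType R)
    (Phi : isometricStarIso E) (m : int) : E -> E :=
  match m with Posz n => iter n Phi | Negz n => iter n.+1 (siso_inv Phi) end.

(* A closed proper ideal, seen as a type, carries the norm topology of the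
   ambient algebra through the library's topology on [set_type A]. *)
Definition closed_proper_ideal (R : realType) (E : comCStarAlgType R)
    (A : set E) : Prop := closed A /\ idealr_closed (mem A).

Definition infinite_dimensional (R : realType) (E : comCStarAlgType R)
    (A : set E) : Prop :=
  forall (n : nat) (v : 'I_n -> A), exists a : A,
    forall c : 'I_n -> R[i], val a != \sum_i c i *: val (v i).

Definition separable (X : topologicalType) : Prop :=
  exists2 D : set X, countable D & dense D.

Definition hypercyclic (X : topologicalType) (T : X -> X) : Prop :=
  exists x : X, dense (range (fun n => iter n T x)).

(* The restriction to [A] of a self-map [f] of [E] preserving [A]. *)
Definition restr (E : Type) (A : set E) (f : E -> E) (fA : set_fun A A f)
  (a : A) : A := SigSub (mem_set (fA (val a) (set_valP a))).

Lemma image_eq_fun (E : Type) (A : set E) (f : E -> E) :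
  f @` A = A -> set_fun A A f.
Proof. by move=> fA a Aa; rewrite -fA; exists a. Qed.

Lemma ideal_mul_fun (R : realType) (E : comCStarAlgType R) (A : set E)
    (f : E -> E) (b : E) :
  closed_proper_ideal A -> set_fun A A f -> set_fun A A (fun a => b * f a).
Proof.
move=> [_ [A0 _ AD]] fA a /fA Aa.
by rewrite -[b * f a]addr0; apply: set_mem; apply: AD => //; exact: mem_set.
Qed.

(* The weighted operator [U_(Phi, b) : a |-> b * Phi a] on the ideal [A]. *)
Definition U_op (R : realType) (E : comCStarAlgType R) (A : set E)
    (AI : closed_proper_ideal A) (Phi : E -> E) (PhiA : Phi @` A = A)
    (b : E) : A -> A :=
  restr (ideal_mul_fun b AI (image_eq_fun PhiA)).

(* The characters of [A], i.e. its nonzero multiplicative linear functionals,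
   inside the space of all functions on [A] with the topology of pointwise
   convergence; the latter induces the weak-* topology on the spectrum. Sums,
   products and multiples of elements of [A] are those of [E]. *)
Definition spectrum (R : realType) (E : comCStarAlgType R) (A : set E) :
    set {ptws A -> R[i]^o} :=
  [set gamma | [/\ exists a : A, gamma a != 0,
    forall (c : R[i]) (x y z : A),
      val z = c *: val x + val y -> gamma z = c * gamma x + gamma y
    & forall x y z : A, val z = val x * val y -> gamma z = gamma x * gamma y]].
Arguments spectrum {R E} A.

(* The characters of the unital algebra [E] are its unital algebra morphisms
   to the complex numbers. *)
Definition extends (R : realType) (E : comCStarAlgType R) (A : set E)
    (chi : {lrmorphism E -> R[i]^o}) (gamma : {ptws A -> R[i]^o}) : Prop :=
  forall a : A, chi (val a) = gamma a.

(* The value at [e] of the extension of [gamma] to a character of [E]. There is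
   at most one extension when [gamma] is a character of an ideal [A]: if
   [gamma a != 0] then [chi e = gamma (e a) / gamma a]. *)
Definition ext_eval (R : realType) (E : comCStarAlgType R) (A : set E)
    (gamma : {ptws A -> R[i]^o}) (e : E) : R[i]^o :=
  get [set z | exists2 chi : {lrmorphism E -> R[i]^o},
                 extends chi gamma & z = chi e].

(* The supremum of a set of nonnegative reals, equal to 0 on the empty set. *)
Definition nnsup (R : realType) (S : set R) : \bar R :=
  ereal_sup (0%E |` [set x%:E | x in S]).

(* Main.v *)
(** Write [W_n(chi)] for the product of the [|chi (Phi^j b)|], [j < n], so that
    [|chi (U^n a)| = W_n(chi) |chi (Phi^n a)|] for every character [chi].

    If [U] is hypercyclic, take [a] in [A] with [|gamma a| >= 1] on [K]. Some
    [v] close to [a] has [U^n v] close to [a] with [n] large. As the compact set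
    of [gamma] with [|gamma a| >= eps] escapes from itself, [a] is small at
    [gamma o Phi^n] and at [gamma o Phi^-n] for [gamma] in [K]; evaluating
    [U^n v] at [gamma] and at [gamma o Phi^-n] then bounds [W_n(gamma)^-1] and
    [W_n(gamma o Phi^-n)].

    Conversely, elements of [A] supported in a compact set of characters are
    dense in [A]. For two such elements [u'], [w'], both [U^n u'] and [U^-n w']
    are small for a suitable [n], so [u' + U^-n w'] is close to [u'] and its
    image under [U^n] is close to [w']: [U] is topologically transitive, and
    Baire's argument gives a dense orbit.

    The Gelfand theory behind the norm estimates is obtained without complex
    analysis. Square roots of [1 - y], [|y| <= 1], come from an iteration
    dominated by its scalar case [y = 1]. They give absolute values of
    self-adjoint elements, hence, modulo a maximal ideal, a real value for each
    self-adjoint [h]: the supremum of the [t] such that the negative part of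
    [h - t] lies in the ideal. They also show that [|h|^2 - h^2] is never
    invertible, so that some character attains the norm. *)

Require Import Defs.
From HB Require Import structures.
From mathcomp Require Import all_boot all_order all_algebra.
From mathcomp Require Import all_classical all_reals all_analysis.
From mathcomp Require Import complex ring lra.

Set Implicit Arguments.
Unset Strict Implicit.
Unset Printing Implicit Defensive.

Import Order.TTheory GRing.Theory Num.Theory.
Import numFieldNormedType.Exports.

Local Open Scope classical_set_scope.
Local Open Scope ring_scope.
Local Open Scope complex_scope.

(** * The real-valued norm *)

Section Norm.
Variables (R : realType) (E : comCStarAlgType R).
Implicit Types (x y z : E) (r s t : R) (c : R[i]).

(** The norm of [E] takes its values in [R[i]]. Its real part carries the same information and
    brings estimates within reach of [lra] and [nra]. *)
Definition rnorm x : R := complex.Re `|x|.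

Lemma rnormE x : (rnorm x)%:C = `|x|.
Proof. by apply: RRe_real; exact: normr_real. Qed.

Lemma rnorm_ge0 x : 0 <= rnorm x.
Proof. by rewrite -ler0c rnormE. Qed.

Lemma rnorm0 : rnorm 0 = 0.
Proof. by rewrite /rnorm normr0. Qed.

Lemma rnorm_eq0 x : rnorm x = 0 -> x = 0.
Proof. by move=> x0; apply/eqP; rewrite -normr_eq0 -rnormE x0. Qed.

Lemma ler_rnormD x y : rnorm (x + y) <= rnorm x + rnorm y.
Proof. by rewrite -lecR rmorphD /= !rnormE ler_normD. Qed.

Lemma rnormN x : rnorm (- x) = rnorm x.
Proof. by rewrite /rnorm normrN. Qed.

Lemma rnormB x y : rnorm (x - y) = rnorm (y - x).
Proof. by rewrite -rnormN opprB. Qed.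

Lemma ler_rnormB z x y : rnorm (x - y) <= rnorm (x - z) + rnorm (z - y).
Proof. by have := ler_rnormD (x - z) (z - y); rewrite addrA subrK. Qed.

Lemma rnormZ c x : rnorm (c *: x) = Normc.normc c * rnorm x.
Proof.
apply: complexI; rewrite rmorphM /= !rnormE normrZ; congr (_ * _).
Qed.

Lemma ler_rnormM x y : rnorm (x * y) <= rnorm x * rnorm y.
Proof. by rewrite -lecR rmorphM /= !rnormE; exact: cnormM. Qed.

Lemma rnorm_star_mul x : rnorm (cstar x * x) = rnorm x ^+ 2.
Proof. by apply: complexI; rewrite rmorphXn /= !rnormE; exact: cnorm_star. Qed.

(** The C*-identity gives [|y|^2 <= |cstar y| |y|]; cancel [|y|], then use the bound at [x] and at
    [cstar x]. *)
Lemma rnorm_star x : rnorm (cstar x) = rnorm x.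
Proof.
suff le_star y : rnorm y <= rnorm (cstar y).
  by apply/eqP; rewrite eq_le le_star -{2}(cstarK x) le_star.
have := rnorm_ge0 y; rewrite le_eqVlt => /predU1P[<-|y0].
  exact: rnorm_ge0.
by rewrite -(ler_pM2r y0) -expr2 -rnorm_star_mul ler_rnormM.
Qed.

Lemma cstarMc x y : cstar (x * y) = cstar x * cstar y.
Proof. by rewrite [LHS]cstarM [RHS]mulrC. Qed.

Lemma cstar1 : cstar (1 : E) = 1.
Proof. by have := cstarMc 1 (cstar 1); rewrite mul1r cstarK mulr1. Qed.

Lemma rnorm1 : rnorm (1 : E) = 1.
Proof.
have := rnorm_star_mul 1; rewrite cstar1 mul1r expr2.
have n0 : rnorm (1 : E) != 0.
  by apply/eqP => /rnorm_eq0 /eqP; rewrite oner_eq0.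
by move/(congr1 (fun r => r / rnorm (1 : E))); rewrite mulfV // mulfK // => <-.
Qed.

(** Real scalars as elements of [E], so that identities mixing scalars and vectors are ring
    identities. *)
Definition scal : {rmorphism R -> E} := in_alg E \o real_complex R.

Lemma scalE r : scal r = r%:C *: (1 : E). Proof. by []. Qed.

Lemma normc_real r : Normc.normc r%:C = `|r|.
Proof. by rewrite /= expr0n addr0 sqrtr_sqr. Qed.

Lemma rnorm_scalM r x : rnorm (scal r * x) = `|r| * rnorm x.
Proof. by rewrite scalE -scalerAl mul1r rnormZ normc_real. Qed.

Lemma rnorm_scal r : rnorm (scal r) = `|r|.
Proof. by rewrite -[scal r]mulr1 rnorm_scalM rnorm1 mulr1. Qed.

Lemma conjcE c : Num.conj c = conjc c. Proof. by []. Qed.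

Lemma cstar0 : cstar (0 : E) = 0.
Proof. by apply: (@addIr _ (cstar 0)); rewrite add0r -cstarD addr0. Qed.

Lemma cstarN x : cstar (- x) = - cstar x.
Proof.
by apply/eqP; rewrite -addr_eq0 -cstarD addNr cstar0.
Qed.

Lemma cstarB x y : cstar (x - y) = cstar x - cstar y.
Proof. by rewrite cstarD cstarN. Qed.

Lemma cstar_scal r : cstar (scal r) = scal r.
Proof. by rewrite scalE cstarZ conjcE cstar1 conjc_real. Qed.

Lemma rnorm_sqr x : cstar x = x -> rnorm (x * x) = rnorm x ^+ 2.
Proof. by move=> xs; rewrite -rnorm_star_mul xs. Qed.

Definition tends (u : nat -> E) l :=
  forall e : R, 0 < e -> exists N, forall n, (N <= n)%N -> rnorm (u n - l) < e.

Lemma ball_rnorm x y r : 0 < r -> ball x r%:C y = (rnorm (x - y) < r).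
Proof. by move=> r0; rewrite -ball_normE /ball_ /= -rnormE ltcR. Qed.

Lemma pos_complex (e : R[i]) : 0 < e -> exists2 r : R, 0 < r & e = r%:C.
Proof.
by case: e => a b; rewrite ltcE /= => /andP[/eqP -> a0]; exists a.
Qed.

Lemma cauchy_tends (u : nat -> E) :
  (forall e : R, 0 < e -> exists N, forall m n,
    (N <= m)%N -> (N <= n)%N -> rnorm (u m - u n) < e) ->
  exists l, tends u l.
Proof.
move=> cu.
have /cauchy_cvgP/cvg_ex[l ul] : cauchy (u @ \oo).
  apply: cauchy_exP => e /pos_complex[r r0 ->].
  have [N uN] := cu _ r0; exists (u N); exists N => // n Nn.
  by rewrite /= ball_rnorm // uN.
exists l => e e0; have /cvg_ballP/(_ e%:C) := ul.
rewrite ltcR => /(_ e0)[N _ Nu]; exists N => n Nn.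
by have := Nu _ Nn; rewrite /= ball_rnorm // rnormB.
Qed.

Lemma closed_tends (A : set E) (u : nat -> E) l :
  closed A -> (forall n, A (u n)) -> tends u l -> A l.
Proof.
move=> cA Au ul; apply: cA => B /nbhs_ballP[e /pos_complex[r r0 ->]] lB.
have [N Nu] := ul _ r0; exists (u N); split=> //; apply: lB.
by rewrite ball_rnorm // rnormB Nu.
Qed.

Lemma ltr0_le r : (forall e : R, 0 < e -> r <= e) -> r <= 0.
Proof. by move=> re; apply/ler_addgt0Pr => e e0; rewrite add0r re. Qed.

Lemma tends_uniq u l m : tends u l -> tends u m -> l = m.
Proof.
move=> ul um; apply/eqP; rewrite -subr_eq0; apply/eqP/rnorm_eq0/eqP.
rewrite eq_le rnorm_ge0 andbT; apply/ltr0_le => e e0.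
have e2 : 0 < e / 2 by rewrite divr_gt0.
have [N1 u1] := ul _ e2; have [N2 u2] := um _ e2.
apply: le_trans (ler_rnormB (u (maxn N1 N2)) _ _) _.
rewrite [e]splitr rnormB lerD // ltW // ?u1 ?u2 ?leq_maxl ?leq_maxr //.
Qed.

Lemma le_rnorm_tends u l r x : tends u l ->
  (exists N, forall n, (N <= n)%N -> rnorm (x - u n) <= r) ->
  rnorm (x - l) <= r.
Proof.
move=> ul [N ur]; apply/ler_addgt0Pr => e e0; have [M uM] := ul _ e0.
apply: le_trans (ler_rnormB (u (maxn N M)) _ _) _.
by rewrite lerD ?ur ?leq_maxl // ltW // uM // leq_maxr.
Qed.

End Norm.
Arguments scal {R} E.

(** * Square roots *)

Section SquareRoot.
Variables (R : realType) (E : comCStarAlgType R).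
Implicit Types (x y z : E) (r s t : R) (n m : nat).

Lemma half_twice x : scal E (2^-1) * (x + x) = x.
Proof.
have h1 : scal E (2^-1) * 2 = 1.
  by rewrite -(rmorph_nat (scal E)) -rmorphM mulVf ?rmorph1.
by rewrite -{3}[x]mul1r -h1; ring.
Qed.

(** A fixed point [z] of this iteration satisfies [(1 - z)^2 = 1 - y]. The scalar sequence
    [sqrt_bnd] is the case [y = 1], which converges to 1. *)
Definition sqrt_iter y n : E := iter n (fun z => scal E (2^-1) * (y + z * z)) 0.
Definition sqrt_bnd n : R := iter n (fun t => 2^-1 * (1 + t * t)) 0.

Lemma sqrt_bnd_ge0 n : 0 <= sqrt_bnd n.
Proof. by elim: n => //= n t0; rewrite mulr_ge0 // addr_ge0 // mulr_ge0. Qed.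

Lemma sqrt_bnd_le1 n : sqrt_bnd n <= 1.
Proof. by elim: n => //= n t1; have := sqrt_bnd_ge0 n; rewrite /=; nra. Qed.

Lemma sqrt_bndS n : sqrt_bnd n.+1 = 2^-1 * (1 + sqrt_bnd n * sqrt_bnd n).
Proof. by []. Qed.

(** The gap [d = 1 - t] evolves by [d - d^2 / 2], hence decays like [2 / n]. The rate does not
    depend on [y] and later serves every iteration with [|y| <= 1]. *)
Lemma sqrt_bnd_rate n : 1 - sqrt_bnd n <= 2 / n.+2%:R.
Proof.
elim: n => [|n IH]; first by rewrite subr0 divff.
have t0 := sqrt_bnd_ge0 n; have t1 := sqrt_bnd_le1 n.
rewrite ler_pdivlMr ?ltr0n // in IH.
have -> : n.+3%:R = n.+2%:R + 1 :> R by rewrite natr1.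
have k2 : (2 : R) <= n.+2%:R by rewrite ler_nat.
rewrite sqrt_bndS; move: (sqrt_bnd n) n.+2%:R t0 t1 IH k2 => t k t0 t1 IH k2.
rewrite ler_pdivlMr; last by lra.
suff: (1 - t) * (1 + t) * (k + 1) <= 4 by lra.
(* By induction [(1 - t) k <= 2]. Multiplying by [1 + t] and adding [(1 - t)(1 + t)] bounds the
   left-hand side by [4 - (1 - t)^2]. *)
have p0 : 0 <= (1 + t) * (2 - (1 - t) * k) by rewrite mulr_ge0 //; lra.
by have := sqr_ge0 (1 - t); lra.
Qed.

Section Fixed.
Variables (y : E) (y1 : rnorm y <= 1).
Local Notation z := (sqrt_iter y).

Lemma sqrt_iter_le n : rnorm (z n) <= sqrt_bnd n.
Proof.
elim: n => [|n IH] /=; first by rewrite rnorm0.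
rewrite rnorm_scalM ger0_norm // ler_wpM2l //.
apply: le_trans (ler_rnormD _ _) _; apply: lerD => //.
by apply: le_trans (ler_rnormM _ _) _; rewrite ler_pM ?rnorm_ge0.
Qed.

(** Both increments factor as a difference of squares, so domination by the scalar increments
    propagates by induction. *)
Lemma sqrt_iter_step n :
  rnorm (z n.+1 - z n) <= sqrt_bnd n.+1 - sqrt_bnd n.
Proof.
elim: n => [|n IH].
  rewrite /= !mul0r !addr0 !subr0 mulr1 rnorm_scalM ger0_norm //.
  by rewrite -[leRHS]mulr1 ler_wpM2l.
have -> : z n.+2 - z n.+1 =
    scal E (2^-1) * ((z n.+1 - z n) * (z n.+1 + z n)).
  by rewrite /=; ring.
have -> : sqrt_bnd n.+2 - sqrt_bnd n.+1 =
    2^-1 * ((sqrt_bnd n.+1 - sqrt_bnd n) * (sqrt_bnd n.+1 + sqrt_bnd n)).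
  by rewrite /=; ring.
rewrite rnorm_scalM ger0_norm // ler_wpM2l //.
apply: le_trans (ler_rnormM _ _) _; rewrite ler_pM ?rnorm_ge0 //.
by apply: le_trans (ler_rnormD _ _) _; rewrite lerD ?sqrt_iter_le.
Qed.

Lemma sqrt_iter_dist n m : (n <= m)%N ->
  rnorm (z m - z n) <= sqrt_bnd m - sqrt_bnd n.
Proof.
move=> /subnK <-; elim: (m - n)%N => [|k IH]; first by rewrite !subrr rnorm0.
apply: le_trans (ler_rnormB (z (k + n)) _ _) _.
by have := sqrt_iter_step (k + n); rewrite addSn; lra.
Qed.

Lemma sqrt_iter_rate n m : (n <= m)%N -> rnorm (z m - z n) <= 2 / n.+2%:R.
Proof.
move=> /sqrt_iter_dist/le_trans; apply; apply: le_trans (sqrt_bnd_rate n).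
by rewrite lerB // sqrt_bnd_le1.
Qed.

Lemma rate_small e : 0 < e -> exists n : nat, 2 / n.+2%:R < e :> R.
Proof.
move=> e0; have e2 : 0 <= 2 / e by rewrite divr_ge0 // ltW.
have [n nP] : exists n : nat, 2 / e < n%:R :> R.
  by exists (Num.bound (2 / e)); exact: archi_boundP.
exists n; rewrite ltr_pdivrMr ?ltr0n // mulrC -ltr_pdivrMr //.
by apply: lt_le_trans nP _; rewrite ler_nat -addn2 leq_addr.
Qed.

Lemma sqrt_iter_cvg : exists l, tends z l.
Proof.
apply: cauchy_tends => e e0; have [n nP] := rate_small e0.
have [N NP] := rate_small (divr_gt0 e0 (ltr0Sn R 1)).
exists N => m k Nm Nk; apply: le_lt_trans (ler_rnormB (z N) _ _) _.
rewrite [e]splitr ltrD // ?(rnormB (z N)); apply: le_lt_trans NP;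
  exact: sqrt_iter_rate.
Qed.

End Fixed.

(* [1 - sqrt (1 - y)] *)
Definition sqrt_lim y : E := xget 0 [set l | tends (sqrt_iter y) l].

Lemma sqrt_limP y : rnorm y <= 1 -> tends (sqrt_iter y) (sqrt_lim y).
Proof. by move=> /sqrt_iter_cvg[l ul]; exact: (xgetI 0 ul). Qed.

Lemma sqrt_lim_rate y n : rnorm y <= 1 ->
  rnorm (sqrt_iter y n - sqrt_lim y) <= 2 / n.+2%:R.
Proof.
move=> y1; apply: le_rnorm_tends (sqrt_limP y1) _.
by exists n => m nm; rewrite rnormB sqrt_iter_rate.
Qed.

Lemma rnorm_sqrt_lim y : rnorm y <= 1 -> rnorm (sqrt_lim y) <= 1.
Proof.
move=> y1; rewrite -rnormN -sub0r; apply: le_rnorm_tends (sqrt_limP y1) _.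
exists 0%N => n _; rewrite sub0r rnormN.
by apply: le_trans (sqrt_iter_le y1 n) (sqrt_bnd_le1 n).
Qed.

Lemma sqrt_lim_fix y : rnorm y <= 1 ->
  sqrt_lim y = scal E (2^-1) * (y + sqrt_lim y * sqrt_lim y).
Proof.
move=> y1; have ul := sqrt_limP y1; set L := sqrt_lim y in ul *.
have L1 : rnorm L <= 1 := rnorm_sqrt_lim y1.
apply: (@tends_uniq _ _ (fun n => sqrt_iter y n.+1)) => e /ul[N Nu].
  by exists N => n Nn; apply: Nu; exact: leqW.
exists N => n Nn /=; set u := sqrt_iter y n.
have -> : scal E (2^-1) * (y + u * u) - scal E (2^-1) * (y + L * L) =
  scal E (2^-1) * ((u + L) * (u - L)) by ring.
rewrite rnorm_scalM ger0_norm //; apply: le_lt_trans (Nu _ Nn).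
rewrite ler_pdivrMl //; apply: le_trans (ler_rnormM _ _) _.
rewrite ler_wpM2r ?rnorm_ge0 //; apply: le_trans (ler_rnormD _ _) _.
have := sqrt_iter_le y1 n; have := sqrt_bnd_le1 n; rewrite -/u; lra.
Qed.

Lemma sqrt_lim_star y : rnorm y <= 1 -> cstar y = y ->
  cstar (sqrt_lim y) = sqrt_lim y.
Proof.
move=> y1 ys; have ul := sqrt_limP y1.
apply: (tends_uniq _ ul) => e /ul[N Nu]; exists N => n Nn.
have -> : sqrt_iter y n = cstar (sqrt_iter y n).
  elim: n {Nn} => [|n IH] /=; first by rewrite cstar0.
  by rewrite cstarMc cstar_scal cstarD cstarMc ys -IH.
by rewrite -cstarB rnorm_star Nu.
Qed.

Definition csqrt y : E := 1 - sqrt_lim (1 - y).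

Lemma csqrtK y : rnorm (1 - y) <= 1 -> csqrt y * csqrt y = y.
Proof.
move=> /sqrt_lim_fix Lf; rewrite /csqrt; set L := sqrt_lim _ in Lf *.
have : L + L = 1 - y + L * L by rewrite {1 2}Lf -mulrDr half_twice.
move=> /(congr1 (fun x => 1 + L * L - x)) LL.
have -> : (1 - L) * (1 - L) = 1 + L * L - (L + L) by ring.
by rewrite LL; ring.
Qed.

Lemma rnorm_csqrt y : rnorm (1 - y) <= 1 -> rnorm (1 - csqrt y) <= 1.
Proof. by move=> y1; rewrite /csqrt opprB addrC subrK rnorm_sqrt_lim. Qed.

Lemma csqrt_star y : rnorm (1 - y) <= 1 -> cstar y = y ->
  cstar (csqrt y) = csqrt y.
Proof.
by move=> y1 ys; rewrite /csqrt cstarB cstar1 sqrt_lim_star // cstarB cstar1 ys.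
Qed.

(** The [n]-th iterate is [n]-Lipschitz in its parameter, and each limit is within [2 / (n + 2)] of
    its [n]-th iterate. Choosing [n] first and then [y - x] small yields uniform continuity. *)
Lemma csqrt_continuous y x n : rnorm (1 - y) <= 1 -> rnorm (1 - x) <= 1 ->
  rnorm (csqrt y - csqrt x) <= n%:R * rnorm (y - x) + 4 / n.+2%:R.
Proof.
move=> y1 x1.
have -> : csqrt y - csqrt x = sqrt_lim (1 - x) - sqrt_lim (1 - y).
  by rewrite /csqrt; ring.
have -> : rnorm (y - x) = rnorm (1 - x - (1 - y)) by congr rnorm; ring.
move: (1 - y) (1 - x) y1 x1 => {}y {}x y1 x1.
have dn : rnorm (sqrt_iter x n - sqrt_iter y n) <= n%:R * rnorm (x - y).
  elim: n => [|n IH] /=; first by rewrite subrr rnorm0 mul0r.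
  set u := sqrt_iter x n in IH *; set v := sqrt_iter y n in IH *.
  have -> : scal E (2^-1) * (x + u * u) - scal E (2^-1) * (y + v * v) =
    scal E (2^-1) * (x - y + (u + v) * (u - v)) by ring.
  rewrite rnorm_scalM ger0_norm // ler_pdivrMl //.
  apply: le_trans (ler_rnormD _ _) _.
  have uv : rnorm ((u + v) * (u - v)) <= 2 * rnorm (u - v).
    apply: le_trans (ler_rnormM _ _) _; rewrite ler_wpM2r ?rnorm_ge0 //.
    apply: le_trans (ler_rnormD _ _) _.
    have := sqrt_iter_le y1 n; have := sqrt_iter_le x1 n.
    have := sqrt_bnd_le1 n; rewrite -/u -/v; lra.
  rewrite -natr1; have := rnorm_ge0 (x - y); lra.
have -> : 4 / n.+2%:R = 2 / n.+2%:R + 2 / n.+2%:R :> R.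
  by rewrite -mulrDl -natrD.
apply: le_trans (ler_rnormB (sqrt_iter x n) _ _) _; rewrite rnormB addrCA.
apply: lerD; first exact: sqrt_lim_rate.
apply: le_trans (ler_rnormB (sqrt_iter y n) _ _) _.
by apply: lerD => //; exact: sqrt_lim_rate.
Qed.

End SquareRoot.

(** * Invertibility, norms and absolute values of self-adjoint elements *)

Section SelfAdjoint.
Variables (R : realType) (E : comCStarAlgType R).
Implicit Types (x y h p q : E) (r s t e : R).

Definition invertible x := exists c, x * c = 1.

Lemma neumann x : rnorm (1 - x) < 1 -> invertible x.
Proof.
set u := 1 - x; set q := rnorm u => q1; have q0 : 0 <= q := rnorm_ge0 _.
(* Partial sums of the geometric series in [u], in Horner form. *)
pose c n := iter n (fun z => 1 + u * z) 0.
have cD n k : c (k + n)%N - c n = u ^+ n * c k.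
  elim: n k => [|n IH] k; first by rewrite addn0 subr0 mul1r.
  by rewrite addnS /= exprS -mulrA -IH; ring.
have cB k : (1 - q) * rnorm (c k) <= 1.
  elim: k => [|k IH] /=; first by rewrite rnorm0 mulr0.
  have := ler_rnormD 1 (u * c k); rewrite rnorm1 => le1.
  have le2 := ler_rnormM u (c k); rewrite -/q in le2.
  have q1' : 0 <= 1 - q by lra.
  have := ler_wpM2l q1' le1; have := ler_wpM2l q1' le2.
  have := ler_wpM2l q0 IH; lra.
have uX n : rnorm (u ^+ n) <= q ^+ n.
  elim: n => [|n IH]; first by rewrite !expr0 rnorm1.
  rewrite !exprS; apply: le_trans (ler_rnormM _ _) _.
  by rewrite ler_pM ?rnorm_ge0.
have [l cl] : exists l, tends c l.
  apply: cauchy_tends => e e0.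
  have qe : 0 < e / 2 * (1 - q) by rewrite mulr_gt0 ?divr_gt0 ?subr_gt0.
  have [N _ /(_ N)/=] : \forall n \near \oo, `|0 - q ^+ n| < e / 2 * (1 - q).
    have /cvg_expr : `|q| < 1 by rewrite ger0_norm.
    by move/cvgrPdist_lt; apply.
  move=> /(_ (leqnn _)); rewrite sub0r normrN ger0_norm ?exprn_ge0 // => qN.
  have half n : (N <= n)%N -> rnorm (c n - c N) < e / 2.
    move=> /subnK <-; rewrite cD; apply: le_lt_trans (ler_rnormM _ _) _.
    have q1' : 0 < 1 - q by lra.
    rewrite -(ltr_pM2r q1'); apply: le_lt_trans qN.
    rewrite -[leRHS]mulr1 -mulrA ler_pM ?rnorm_ge0 //.
      by rewrite mulr_ge0 ?rnorm_ge0 // ltW.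
    by rewrite mulrC cB.
  exists N => m n Nm Nn; apply: le_lt_trans (ler_rnormB (c N) _ _) _.
  by rewrite [e]splitr (rnormB (c N)) ltrD ?half.
exists l; suff : l = 1 + u * l.
  by move=> /(congr1 (fun z => z - u * l)); rewrite addrK /u => <-; ring.
apply: (@tends_uniq _ _ (fun n => c n.+1)) => e e0.
  by have [N NP] := cl _ e0; exists N => n Nn; apply: NP; exact: leqW.
have [N NP] := cl _ e0; exists N => n Nn /=.
have -> : 1 + u * c n - (1 + u * l) = u * (c n - l) by ring.
apply: le_lt_trans (ler_rnormM _ _) _; apply: le_lt_trans (NP _ Nn).
by rewrite -[leRHS]mul1r ler_wpM2r ?rnorm_ge0 // ltW.
Qed.

Lemma neumann_scal r x : rnorm (scal E r - x) < r -> invertible x.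
Proof.
move=> rx; have r0 : 0 < r := le_lt_trans (rnorm_ge0 _) rx.
have [c cP] : invertible (scal E r^-1 * x).
  apply: neumann; have -> : 1 - scal E r^-1 * x = scal E r^-1 * (scal E r - x).
    by rewrite mulrBr -rmorphM mulVf ?gt_eqF // rmorph1.
  by rewrite rnorm_scalM gtr0_norm ?invr_gt0 // ltr_pdivrMl // mulr1.
by exists (scal E r^-1 * c); rewrite -cP; ring.
Qed.

Definition imag_unit : E := 'i *: 1.

Lemma imag_unit_sqr : imag_unit * imag_unit = -1.
Proof.
by rewrite /imag_unit -scalerAl mul1r scalerA -expr2 sqr_i scaleN1r.
Qed.

Lemma imag_unit_star : cstar imag_unit = - imag_unit.
Proof.
rewrite /imag_unit cstarZ conjcE cstar1 -scaleNr; congr (_ *: _).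
by rewrite /= -[RHS]/(- (0 : R) +i* (- 1)) oppr0.
Qed.

(* [p + i q] and [p - i q] have the same norm, and their product is
   [p ^ 2 + q ^ 2]. *)
Lemma rnorm_sum_sqr p q : cstar p = p -> cstar q = q ->
  rnorm p ^+ 2 <= rnorm (p * p + q * q).
Proof.
move=> ps qs; set z := p + imag_unit * q.
have zs : cstar z = p - imag_unit * q.
  by rewrite cstarD cstarMc imag_unit_star ps qs mulNr.
have zz : cstar z * z = p * p + q * q.
  transitivity (p * p - (imag_unit * imag_unit) * (q * q)).
    by rewrite zs /z; ring.
  by rewrite imag_unit_sqr; ring.
rewrite -zz rnorm_star_mul ler_pXn2r ?nnegrE ?rnorm_ge0 //.
have -> : p = scal E 2^-1 * (z + cstar z).
  by rewrite zs /z addrACA subrr addr0 half_twice.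
rewrite rnorm_scalM ger0_norm // ler_pdivrMl //.
by apply: le_trans (ler_rnormD _ _) _; rewrite rnorm_star; lra.
Qed.

Lemma rnorm_sqr_le1 h : rnorm h <= 1 -> rnorm (h * h) <= 1.
Proof.
move=> h1; apply: le_trans (ler_rnormM _ _) _.
by rewrite mulr_ile1 ?rnorm_ge0.
Qed.

Lemma csqrt_one_minus_sqr h : cstar h = h -> rnorm h <= 1 ->
  exists2 w, cstar w = w & w * w = 1 - h * h.
Proof.
move=> hs h1; have hh : rnorm (1 - (1 - h * h)) <= 1.
  by rewrite opprB addrC subrK rnorm_sqr_le1.
exists (csqrt (1 - h * h)); last exact: csqrtK.
by rewrite csqrt_star // cstarB cstar1 cstarMc hs.
Qed.

(** Let [c] be the inverse of [1 - h^2], with [w^2 = 1 - h^2] and [v^2 = 1 - c / m]. Then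
    [h^2 + (w v)^2 = 1 - 1 / m], and [rnorm_sum_sqr] gives [|h|^2 <= 1 - 1 / m]. *)
Lemma invertible_one_minus_sqr h : cstar h = h -> rnorm h <= 1 ->
  invertible (1 - h * h) -> rnorm h < 1.
Proof.
move=> hs h1 [c hc]; have [w ws ww] := csqrt_one_minus_sqr hs h1.
have cs : cstar c = c.
  have := congr1 cstar hc; rewrite cstarMc cstarB cstarMc hs cstar1 => hc'.
  by rewrite -[LHS]mul1r -hc mulrAC hc' mul1r.
pose m := rnorm c + 1; have m1 : 1 <= m by rewrite lerDr rnorm_ge0.
have m0 : 0 < m by lra.
have y1 : rnorm (1 - (1 - scal E m^-1 * c)) <= 1.
  rewrite opprB addrC subrK rnorm_scalM gtr0_norm ?invr_gt0 //.
  by rewrite ler_pdivrMl // mulr1 /m; lra.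
pose v := csqrt (1 - scal E m^-1 * c).
have vv : v * v = 1 - scal E m^-1 * c by exact: csqrtK.
have vs : cstar v = v.
  by rewrite csqrt_star // cstarB cstar1 cstarMc cstar_scal cs.
have := rnorm_sum_sqr hs (_ : cstar (w * v) = w * v).
have -> : h * h + w * v * (w * v) = scal E (1 - m^-1).
  transitivity (h * h + (w * w) * (v * v)); first by ring.
  rewrite ww vv rmorphB rmorph1.
  transitivity (1 - scal E m^-1 * ((1 - h * h) * c)); first by ring.
  by rewrite hc mulr1.
rewrite cstarMc ws vs rnorm_scal => /(_ erefl).
have mi : m^-1 <= 1 by rewrite invf_le1.
have mi0 : 0 < m^-1 by rewrite invr_gt0.
rewrite ger0_norm ?subr_ge0 // => le.
rewrite ltNge; apply/negP => h1'; have := rnorm_ge0 h; nra.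
Qed.

(** Rescaling to norm 1 contradicts the previous lemma. This replaces the spectral radius formula:
    [|h|^2] lies in the spectrum of [h^2]. *)
Lemma rnorm_not_invertible h : cstar h = h -> h != 0 ->
  ~ invertible (scal E (rnorm h ^+ 2) - h * h).
Proof.
move=> hs h0 [c hc]; pose r := rnorm h.
have r0 : 0 < r.
  rewrite lt_def rnorm_ge0 andbT; apply: contra h0 => /eqP/rnorm_eq0 ->.
  by [].
have rr : scal E r * scal E r^-1 = 1.
  by rewrite -rmorphM mulfV ?gt_eqF // rmorph1.
have n1 : rnorm (scal E r^-1 * h) = 1.
  by rewrite rnorm_scalM gtr0_norm ?invr_gt0 // mulVf ?gt_eqF.
have : rnorm (scal E r^-1 * h) < 1.
  apply: invertible_one_minus_sqr; rewrite ?n1 ?cstarMc ?cstar_scal ?hs //.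
  exists (scal E r * scal E r * c); rewrite -[RHS]hc rmorphXn -/r.
  move: (scal E r) (scal E r^-1) rr => S T ST.
  transitivity ((S ^+ 2 - (S * T) ^+ 2 * (h * h)) * c); first by ring.
  by rewrite ST expr1n mul1r.
by rewrite n1 ltxx.
Qed.

(** With [w^2 = 1 - h^2], the sum [w^2 + h^2] is 1, so [|w| <= 1]. This places [h * h] in the domain
    where [csqrt] is a square root. *)
Lemma rnorm_one_minus_sqr h : cstar h = h -> rnorm h <= 1 ->
  rnorm (1 - h * h) <= 1.
Proof.
move=> hs h1; have [w ws ww] := csqrt_one_minus_sqr hs h1.
rewrite -ww rnorm_sqr //; apply: le_trans (rnorm_sum_sqr ws hs) _.
by rewrite ww subrK rnorm1.
Qed.

Definition cabs h := csqrt (h * h).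

Lemma cabsK h : cstar h = h -> rnorm h <= 1 -> cabs h * cabs h = h * h.
Proof. by move=> hs h1; rewrite csqrtK ?rnorm_one_minus_sqr. Qed.

Lemma rnorm_cabs h : cstar h = h -> rnorm h <= 1 -> rnorm (1 - cabs h) <= 1.
Proof. by move=> hs h1; rewrite rnorm_csqrt ?rnorm_one_minus_sqr. Qed.

Lemma cabs_star h : cstar h = h -> rnorm h <= 1 -> cstar (cabs h) = cabs h.
Proof.
by move=> hs h1; rewrite csqrt_star ?rnorm_one_minus_sqr // cstarMc hs.
Qed.

Lemma cabs_continuous e : 0 < e -> exists2 d, 0 < d &
  forall h (k : E), cstar h = h -> cstar k = k -> rnorm h <= 1 -> rnorm k <= 1 ->
    rnorm (h - k) < d -> rnorm (cabs h - cabs k) < e.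
Proof.
move=> e0; have [n ne] := @rate_small R (e / 4) (divr_gt0 e0 (ltr0Sn _ _)).
have n0 : (0 : R) <= n%:R by rewrite ler0n.
have d0 : 0 < 4 * (n%:R + 1) :> R by lra.
(* Since [|h^2 - k^2| <= 2 |h - k|], the Lipschitz part stays below [e / 2]; the choice of [n] keeps
   [4 / (n + 2)] below [e / 2]. *)
exists (e / (4 * (n%:R + 1))); first by rewrite divr_gt0.
move=> h k hs ks h1 k1; rewrite ltr_pdivlMr // => hk.
apply: le_lt_trans (csqrt_continuous n _ _) _; rewrite ?rnorm_one_minus_sqr //.
have -> : 4 / n.+2%:R = 2 / n.+2%:R + 2 / n.+2%:R :> R.
  by rewrite -mulrDl -natrD.
have : rnorm (h * h - k * k) <= 2 * rnorm (h - k).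
  have -> : h * h - k * k = (h + k) * (h - k) by ring.
  apply: le_trans (ler_rnormM _ _) _; rewrite ler_wpM2r ?rnorm_ge0 //.
  by apply: le_trans (ler_rnormD _ _) _; lra.
move: (2 / n.+2%:R) hk ne n0.
move: (rnorm (h * h - k * k)) (rnorm (h - k)) (rnorm_ge0 (h - k)) => a r r0.
move=> c; move: n%:R => N; nra.
Qed.

End SelfAdjoint.
Arguments imag_unit {R} E.

(** * Characters from maximal ideals *)

Section MaximalIdeals.
Variables (R : realType) (E : comCStarAlgType R).
Implicit Types (x y h : E) (r s t e : R) (I : set E).

(** Maximality is expressed as the quotient being a field: each element outside [I] has an inverse
    modulo [I]. *)
Record maximal_ideal I : Prop := MaximalIdeal {
  mxideal0 : I 0 ;
  mxidealD : forall x y, I x -> I y -> I (x + y) ;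
  mxidealM : forall c x, I x -> I (c * x) ;
  mxideal1 : ~ I 1 ;
  mxideal_inv : forall x, ~ I x -> exists c, I (1 - c * x)
}.

(* Zorn's lemma for sets closed under unions of chains quantifies over the
   empty chain too, so the empty set is tolerated among the candidates. *)
Lemma maximal_ideal_exists x : ~ invertible x ->
  exists2 I, maximal_ideal I & I x.
Proof.
move=> x_noninv.
pose P I := [/\ forall y z, I y -> I z -> I (y + z),
  forall c y, I y -> I (c * y), ~ I 1 & forall y, I y -> I x].
have [|I [PI Imax]] := @Zorn_bigcup E P.
  move=> F FP Ftot; split.
  - move=> y z [X FX Xy] [Y FY Yz].
    have [XY|YX] := Ftot _ _ FX FY.
      by exists Y => //; have [YD _ _ _] := FP _ FY; apply: YD => //; apply: XY.
    by exists X => //; have [XD _ _ _] := FP _ FX; apply: XD => //; apply: YX.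
  - move=> c y [X FX Xy]; exists X => //.
    by have [_ XM _ _] := FP _ FX; apply: XM.
  - by move=> [X FX X1]; have [_ _ /(_ X1)] := FP _ FX.
  - move=> y [X FX Xy]; exists X => //.
    by have [_ _ _ Xx] := FP _ FX; apply: Xx Xy.
have [ID IM I1 Ix] := PI.
have xI : I x.
  apply: contrapT => nIx; have I0 : I = set0.
    by apply/seteqP; split=> // y /Ix.
  (* The empty candidate is not maximal: the principal ideal of [x] is proper and larger. *)
  apply: (Imax [set c * x | c in setT]).
    rewrite I0; split; last by move/(_ x); apply; exists 1; rewrite ?mul1r.
    by move=> y.
  split.
  - by move=> _ _ [c _ <-] [d _ <-]; exists (c + d); rewrite ?mulrDl.
  - by move=> d _ [c _ <-]; exists (d * c); rewrite ?mulrA.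
  - by move=> [c _ cx]; apply: x_noninv; exists c; rewrite mulrC.
  - by move=> _ _; exists 1; rewrite ?mul1r.
exists I => //; split=> //; first by have := IM 0 x xI; rewrite mul0r.
move=> y nIy; apply: contrapT => noc.
(* The ideal [I + E y] is proper because [y] has no inverse modulo [I], and it strictly contains
   [I]. *)
apply: (Imax [set z | exists c, I (z - c * y)]).
  split=> [z Iz|IJ]; first by exists 0; rewrite mul0r subr0.
  apply: nIy; apply: IJ; exists 1; rewrite mul1r subrr.
  by have := IM 0 x xI; rewrite mul0r.
split.
- move=> z w [c Ic] [d Id]; exists (c + d).
  have -> : z + w - (c + d) * y = (z - c * y) + (w - d * y) by ring.
  exact: ID.
- move=> d z [c Ic]; exists (d * c).
  have -> : d * z - d * c * y = d * (z - c * y) by ring.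
  exact: IM.
- exact: noc.
- by move=> _ _; exists 0; rewrite mul0r subr0.
Qed.

Section Fixed.
Variables (I : set E) (IP : maximal_ideal I).

Lemma mxidealB x y : I x -> I y -> I (x - y).
Proof.
by move=> Ix Iy; apply: mxidealD => //; rewrite -mulN1r; exact: mxidealM.
Qed.

Lemma mxideal_noninv x : I x -> ~ invertible x.
Proof.
by move=> Ix [c xc]; apply: (mxideal1 IP); rewrite -xc mulrC; exact: mxidealM.
Qed.

Lemma mxideal_prime x y : I (x * y) -> I x \/ I y.
Proof.
move=> Ixy; have [?|/(mxideal_inv IP)[c Ic]] := pselect (I x); first by left.
right; have -> : y = y * (1 - c * x) + c * (x * y) by ring.
by apply: mxidealD => //; exact: mxidealM.
Qed.

(** If [c] inverts [x] modulo [I] and [y] in [I] is close to [x], then [1 - c x + c y] lies in [I]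
    and near 1, so it is invertible, a contradiction. *)
Lemma mxideal_closed x :
  (forall e, 0 < e -> exists2 y, I y & rnorm (x - y) < e) -> I x.
Proof.
move=> Ix; apply: contrapT => /(mxideal_inv IP)[c Ic].
have c0 : 0 < rnorm c + 1 by rewrite ltr_wpDl ?rnorm_ge0.
have [|y Iy] := Ix (rnorm c + 1)^-1; first by rewrite invr_gt0.
rewrite -[ltRHS]mulr1 ltr_pdivlMl // => xy.
have Iz : I (1 - c * x + c * y) by apply: mxidealD => //; exact: mxidealM.
apply: (mxideal_noninv Iz); apply: neumann.
have -> : 1 - (1 - c * x + c * y) = c * (x - y) by ring.
apply: le_lt_trans (ler_rnormM _ _) _; apply: le_lt_trans xy.
by rewrite ler_wpM2r ?rnorm_ge0 // lerDl.
Qed.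

Section Real.
Variables (h : E) (hs : cstar h = h) (h1 : rnorm h < 2^-1).

Let k t := h - scal E t.

Let k_star t : cstar (k t) = k t.
Proof. by rewrite cstarB cstar_scal hs. Qed.

Let k_le1 t : `|t| <= 2^-1 -> rnorm (k t) <= 1.
Proof.
move=> t1; apply: le_trans (ler_rnormD _ _) _.
by rewrite rnormN rnorm_scal; move: h1 t1; lra.
Qed.

Let pos_or_neg t : `|t| <= 2^-1 -> I (cabs (k t) - k t) \/ I (cabs (k t) + k t).
Proof.
move=> t1; apply: mxideal_prime.
have -> : (cabs (k t) - k t) * (cabs (k t) + k t) =
  cabs (k t) * cabs (k t) - k t * k t by ring.
by rewrite cabsK ?k_le1 // subrr; exact: mxideal0.
Qed.

Let k_continuous e : 0 < e -> exists2 d, 0 < d & forall s t,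
  `|s| <= 2^-1 -> `|t| <= 2^-1 -> `|s - t| < d ->
  rnorm (cabs (k s) - k s - (cabs (k t) - k t)) < e /\
  rnorm (cabs (k s) + k s - (cabs (k t) + k t)) < e.
Proof.
move=> e0; have e2 : 0 < e / 2 by rewrite divr_gt0.
have [d d0 dP] := cabs_continuous E e2.
exists (Num.min d (e / 2)); first by rewrite lt_min d0.
move=> s t s1 t1; rewrite lt_min => /andP[std ste].
have kst : rnorm (k s - k t) = `|s - t|.
  have -> : k s - k t = scal E (t - s) by rewrite /k; ring.
  by rewrite rnorm_scal distrC.
have ast : rnorm (cabs (k s) - cabs (k t)) < e / 2.
  by apply: dP; rewrite ?k_le1 ?kst.
rewrite [e]splitr; split.
  have -> : cabs (k s) - k s - (cabs (k t) - k t) =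
    cabs (k s) - cabs (k t) + (k t - k s) by ring.
  by apply: le_lt_trans (ler_rnormD _ _) _; rewrite ltrD // rnormB kst.
have -> : cabs (k s) + k s - (cabs (k t) + k t) =
  cabs (k s) - cabs (k t) + (k s - k t) by ring.
by apply: le_lt_trans (ler_rnormD _ _) _; rewrite ltrD // kst.
Qed.

(* [cabs (k t) - k t] is twice the negative part of [h - t]; the value sought
   is the supremum of the [t] at which it lies in [I]. *)
Lemma mxideal_small_real : exists t, I (h - scal E t).
Proof.
have half0 : (0 : R) < 2^-1 by [].
have hN : `|2^-1| <= 2^-1 :> R by rewrite ger0_norm // ltW.
pose S := [set t : R | `|t| <= 2^-1 /\ I (cabs (k t) - k t)].
have Sub : ubound S 2^-1 by move=> t [+ _]; rewrite ler_norml => /andP[].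
have S0 : S (- 2^-1).
  have hN' : `|- 2^-1| <= 2^-1 :> R by rewrite normrN.
  split=> //; have [//|Ik] := pos_or_neg hN'.
  (* At [t = -1/2] the element [cabs (k t) + k t] lies at distance less than [1 + 1/2] from that
     scalar, so it is invertible. *)
  exfalso; apply: (mxideal_noninv Ik); apply: (@neumann_scal _ _ (1 + 2^-1)).
  have -> : scal E (1 + 2^-1) - (cabs (k (- 2^-1)) + k (- 2^-1)) =
    1 - cabs (k (- 2^-1)) - h by rewrite /k; ring.
  apply: le_lt_trans (ler_rnormD _ _) _; rewrite rnormN.
  by apply: ler_ltD => //; rewrite rnorm_cabs ?k_le1 ?normrN.
have supS : has_sup S by split; [exists (- 2^-1) | exists 2^-1].
pose l := sup S.
have l1 : `|l| <= 2^-1.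
  rewrite ler_norml ub_le_sup //=; last by exists 2^-1.
  by apply: ge_sup => //; exists (- 2^-1).
(* The supremum belongs to [S], as [I] is closed and [cabs (k t) - k t] depends continuously on
   [t]. *)
have Il : I (cabs (k l) - k l).
  apply: mxideal_closed => e e0; have [d d0 dP] := k_continuous e0.
  have [t St tl] := sup_adherent d0 supS; have [t1 It] := St.
  exists (cabs (k t) - k t) => //; have [] // := dP l t l1 t1.
  have tl' : t <= l by apply: ub_le_sup => //; exists 2^-1.
  by rewrite ger0_norm ?subr_ge0 // ltrBlDr addrC -ltrBlDr.
have l_lt : l < 2^-1.
  rewrite lt_neqAle; move: (l1); rewrite ler_norml => /andP[_ ->].
  rewrite andbT.
  apply/eqP => l2; apply: (mxideal_noninv Il).
  apply: (@neumann_scal _ _ (1 + 2^-1)); rewrite l2.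
  have -> : scal E (1 + 2^-1) - (cabs (k 2^-1) - k 2^-1) =
    1 - cabs (k 2^-1) + h by rewrite /k; ring.
  apply: le_lt_trans (ler_rnormD _ _) _.
  by apply: ler_ltD => //; rewrite rnorm_cabs ?k_le1.
(* Just above [l] the first alternative of [pos_or_neg] fails, so the second holds; let [t] decrease
   to [l]. The room above [l] is given by [l_lt]. *)
have Il' : I (cabs (k l) + k l).
  apply: mxideal_closed => e e0; have [d d0 dP] := k_continuous e0.
  pose t := Num.min 2^-1 (l + d / 2).
  have lt : l < t by rewrite lt_min l_lt ltrDl divr_gt0.
  have t1 : `|t| <= 2^-1.
    rewrite ler_norml ge_min lexx andbT; apply: le_trans (ltW lt).
    by move: l1; rewrite ler_norml => /andP[].
  exists (cabs (k t) + k t).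
    have [It|//] := pos_or_neg t1.
    have : t <= l by apply: ub_le_sup; [exists 2^-1 | split].
    by rewrite leNgt lt.
  have [] // := dP l t l1 t1.
  rewrite distrC ger0_norm ?subr_ge0 1?ltW // ltrBlDl.
  rewrite (le_lt_trans (_ : _ <= l + d / 2)) ?ge_min ?lexx ?orbT //.
  by rewrite ltrD2l; lra.
exists l; have -> : h - scal E l =
    scal E 2^-1 * (cabs (k l) + k l - (cabs (k l) - k l)).
  have -> : cabs (k l) + k l - (cabs (k l) - k l) = k l + k l by ring.
  by rewrite half_twice.
by apply: mxidealM => //; exact: mxidealB.
Qed.

End Real.

Lemma mxideal_real h : cstar h = h -> exists t, I (h - scal E t).
Proof.
move=> hs; pose m := 2 * (rnorm h + 1).
have m0 : 0 < m by rewrite mulr_gt0 // ltr_wpDl ?rnorm_ge0.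
have mm : scal E m * scal E m^-1 = 1.
  by rewrite -rmorphM mulfV ?gt_eqF // rmorph1.
have [||t It] := @mxideal_small_real (scal E m^-1 * h).
- by rewrite cstarMc cstar_scal hs.
- rewrite rnorm_scalM gtr0_norm ?invr_gt0 // ltr_pdivrMl //.
  by rewrite /m mulrAC mulfV // mul1r ltrDl.
exists (m * t); have -> : h - scal E (m * t) =
    scal E m * (scal E m^-1 * h - scal E t).
  by rewrite mulrBr mulrA mm mul1r -rmorphM.
exact: mxidealM.
Qed.

(** This is Gelfand-Mazur for the quotient by [I], reduced to the self-adjoint case by writing
    [x = a + i b]. *)
Lemma mxideal_complex x : exists c : R[i], I (x - c%:A).
Proof.
pose a := scal E 2^-1 * (x + cstar x).
pose b := scal E 2^-1 * (imag_unit E * (cstar x - x)).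
have as_ : cstar a = a.
  by rewrite cstarMc cstar_scal cstarD cstarK addrC.
have bs : cstar b = b.
  rewrite cstarMc cstar_scal cstarMc cstarB cstarK imag_unit_star.
  by rewrite mulNr -mulrN opprB.
have [r Ir] := mxideal_real as_; have [s Is] := mxideal_real bs.
exists (r +i* s).
have -> : x - (r +i* s)%:A = (a - scal E r) + imag_unit E * (b - scal E s).
  have xab : x = a + imag_unit E * b.
    transitivity (a + scal E 2^-1 * (imag_unit E * imag_unit E * (cstar x - x))).
      rewrite imag_unit_sqr mulN1r opprB /a -mulrDr.
      by rewrite addrACA subrr addr0 half_twice.
    by rewrite /b; ring.
  have -> : (r +i* s)%:A = scal E r + imag_unit E * scal E s.
    rewrite !scalE /imag_unit -scalerAl mul1r scalerA -scalerDl; congr (_ *: _).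
    by apply/eqP; rewrite eq_complex /=; apply/andP; split; apply/eqP; ring.
  by rewrite {1}xab; ring.
by apply: mxidealD => //; exact: mxidealM.
Qed.

Lemma mxideal_scalar_uniq (c d : R[i]) : I (c%:A - d%:A) -> c = d.
Proof.
move=> Icd; apply/eqP; rewrite -subr_eq0; apply/negPn/negP => cd.
apply: (mxideal_noninv Icd); exists (c - d)^-1%:A.
by rewrite -scalerBl -scalerAl mul1r scalerA divff // scale1r.
Qed.

Definition mxideal_eval x : R[i]^o :=
  xget (0 : R[i]) [set c : R[i] | I (x - c%:A)].

Lemma mxideal_evalP x : I (x - (mxideal_eval x : R[i])%:A).
Proof. have [c xc] := mxideal_complex x.
exact: (@xgetI _ (0 : R[i]) [set c : R[i] | I (x - c%:A)] c xc). Qed.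

Lemma mxideal_evalE x (c : R[i]) : I (x - c%:A) -> mxideal_eval x = c.
Proof.
move=> Ic; apply: mxideal_scalar_uniq; set d : R[i] := mxideal_eval x.
have -> : d%:A - c%:A = (x - c%:A) - (x - d%:A) by ring.
by apply: mxidealB => //; exact: mxideal_evalP.
Qed.

Lemma mxideal_eval_linear : linear mxideal_eval.
Proof.
move=> c x y; apply: mxideal_evalE.
set u := mxideal_eval x; set v := mxideal_eval y.
have -> : c *: x + y - (c *: u + v)%:A = c%:A * (x - u%:A) + (y - v%:A).
  rewrite mulrBr -!scalerAl !mul1r scalerDl -scalerA; ring.
by apply: mxidealD => //; [apply: mxidealM => // |]; exact: mxideal_evalP.
Qed.

Lemma mxideal_eval_monoid : monoid_morphism mxideal_eval.
Proof.
split=> [|x y]; apply: mxideal_evalE.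
  by rewrite scale1r subrr; exact: mxideal0.
set u := mxideal_eval x; set v := mxideal_eval y.
have -> : x * y - (u * v)%:A = y * (x - u%:A) + u%:A * (y - v%:A).
  by rewrite mulrBr mulrBr (mulrC y u%:A) (_ : (u * v)%:A = u%:A * v%:A);
    [ring | rewrite -scalerAl mul1r scalerA].
by apply: mxidealD => //; apply: mxidealM => //; exact: mxideal_evalP.
Qed.

End Fixed.

Lemma maximal_ideal_character I : maximal_ideal I ->
  exists chi : {lrmorphism E -> R[i]^o}, forall x, I x -> chi x = 0.
Proof.
move=> IP.
pose L := GRing.isLinear.Build _ _ _ _ (mxideal_eval I) (mxideal_eval_linear IP).
pose M := GRing.isMonoidMorphism.Build _ _ (mxideal_eval I) (mxideal_eval_monoid IP).
pose chi : {lrmorphism E -> R[i]^o} := HB.pack (mxideal_eval I) L M.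
exists chi => x Ix; apply: mxideal_evalE => //.
by rewrite scale0r subr0.
Qed.

Lemma character_noninvertible x : ~ invertible x ->
  exists chi : {lrmorphism E -> R[i]^o}, chi x = 0.
Proof.
move=> /maximal_ideal_exists[I /maximal_ideal_character[chi chi0] Ix].
by exists chi; exact: chi0.
Qed.

End MaximalIdeals.

(** * Characters, norming and cutoff functions *)

Section Characters.
Variables (R : realType) (E : comCStarAlgType R).
Implicit Types (x y h p u : E) (r s t e : R) (chi : {lrmorphism E -> R[i]^o}).
Local Notation normc := (@Normc.normc R).

Lemma normc_ge0 (c : R[i]) : 0 <= normc c.
Proof. by case: c => a b; exact: sqrtr_ge0. Qed.

Lemma normc_sqr (c : R[i]) :
  normc c ^+ 2 = complex.Re c ^+ 2 + complex.Im c ^+ 2.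
Proof. by case: c => a b; rewrite sqr_sqrtr // addr_ge0 ?sqr_ge0. Qed.

Lemma normc_gt0 (c : R[i]) : (0 < normc c) = (c != 0).
Proof.
rewrite lt_def normc_ge0 andbT; congr negb; apply/eqP/eqP => [|->].
  exact: Normc.eq0_normc.
exact: Normc.normc0.
Qed.

(* The canonical structures on [E] are convertible along several paths;
   this wrapper fixes one of them. *)
Definition ev chi x : R[i] := chi x.

Lemma charD chi x y : ev chi (x + y) = ev chi x + ev chi y.
Proof. exact: rmorphD. Qed.

Lemma charB chi x y : ev chi (x - y) = ev chi x - ev chi y.
Proof. exact: rmorphB. Qed.

Lemma charM chi x y : ev chi (x * y) = ev chi x * ev chi y.
Proof. exact: rmorphM. Qed.

Lemma char1 chi : ev chi 1 = 1.
Proof. exact: rmorph1. Qed.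

Lemma char_alg chi (c : R[i]) : ev chi (c%:A) = c.
Proof. by rewrite /ev linearZ /= rmorph1 [LHS]mulr1. Qed.

Lemma char_scal chi r : ev chi (scal E r) = r%:C.
Proof. exact: char_alg. Qed.

Lemma charZ chi (c : R[i]) x : ev chi (c *: x) = c * ev chi x.
Proof. by rewrite /ev linearZ. Qed.

Lemma char_invertible chi x : invertible x -> ev chi x != 0.
Proof.
move=> [c xc]; apply/eqP => x0; have := charM chi x c.
by rewrite xc x0 mul0r char1 => /eqP; rewrite oner_eq0.
Qed.

(** If [|chi x| > |x|], then [1 - x / chi x] is invertible by the Neumann series, yet [chi] sends it
    to 0. *)
Lemma char_le chi x : normc (ev chi x) <= rnorm x.
Proof.
rewrite leNgt; apply/negP => lt.
have c0 : ev chi x != 0.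
  by rewrite -normc_gt0; apply: le_lt_trans lt; exact: rnorm_ge0.
have : invertible (1 - (ev chi x)^-1 *: x).
  apply: neumann; rewrite opprB addrC subrK rnormZ Normc.normcV.
  by rewrite ltr_pdivrMl ?mulr1 // normc_gt0.
move/(char_invertible chi)/eqP; apply.
by rewrite charB char1 charZ mulVf // subrr.
Qed.

(* Arens' trick: [h + i t] has norm at most [sqrt (|h| ^ 2 + t ^ 2)]. *)
Lemma char_real chi h : cstar h = h -> complex.Im (ev chi h) = 0.
Proof.
move=> hs; set b := complex.Im _; set a := complex.Re (ev chi h).
have le t : a ^+ 2 + (b + t) ^+ 2 <= rnorm h ^+ 2 + t ^+ 2.
  pose x := h + imag_unit E * scal E t.
  have -> : a ^+ 2 + (b + t) ^+ 2 = normc (ev chi x) ^+ 2.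
    rewrite normc_sqr /x charD charM char_scal charZ char1.
    rewrite /a /b; case: (ev chi h) => u v /=.
    by congr (_ ^+ 2 + _ ^+ 2); ring.
  apply: le_trans (_ : rnorm x ^+ 2 <= _).
    by rewrite ler_pXn2r ?nnegrE ?normc_ge0 ?rnorm_ge0 ?char_le.
  rewrite -rnorm_star_mul.
  have -> : cstar x * x = h * h + scal E (t ^+ 2).
    rewrite cstarD cstarMc imag_unit_star cstar_scal hs.
    transitivity (h * h - imag_unit E * imag_unit E * scal E (t ^+ 2)).
      by rewrite /x; ring.
    by rewrite imag_unit_sqr; ring.
  apply: le_trans (ler_rnormD _ _) _.
  by rewrite rnorm_scal rnorm_sqr // ger0_norm ?sqr_ge0.
apply/eqP/negPn/negP => b0.
(* This [t] makes [2 b t = |h|^2 + 1], which exceeds what [le] allows. *)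
have := le ((rnorm h ^+ 2 + 1) / (2 * b)); set t := _ / _.
have -> : (b + t) ^+ 2 = b ^+ 2 + (rnorm h ^+ 2 + 1) + t ^+ 2.
  by rewrite /t; field.
have := sqr_ge0 a; have := sqr_ge0 b; lra.
Qed.

Lemma char_star chi x : ev chi (cstar x) = conjc (ev chi x).
Proof.
have : complex.Im (ev chi (cstar x + x) : R[i]) = 0.
  by apply: char_real; rewrite cstarD cstarK addrC.
have : complex.Im (ev chi (imag_unit E * (cstar x - x)) : R[i]) = 0.
  apply: char_real; rewrite cstarMc cstarB cstarK imag_unit_star.
  by rewrite mulNr -mulrN opprB.
rewrite charM charB charD charZ char1.
case: (ev chi x) => a b; case: (ev chi (cstar x)) => c d /= E1 E2.
by apply/eqP; rewrite eq_complex /=; apply/andP; split; apply/eqP; lra.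
Qed.

Lemma char_star_mul chi x : ev chi (cstar x * x) = (normc (ev chi x) ^+ 2)%:C.
Proof.
rewrite charM char_star normc_sqr; case: (ev chi x) => a b /=.
by apply/eqP; rewrite eq_complex /=; apply/andP; split; apply/eqP; ring.
Qed.

(** For [h = cstar x * x], some character kills the non-invertible [|h|^2 - h^2]. As
    [chi h = |chi x|^2], this reads [|chi x|^4 = |x|^4]. *)
Lemma char_norming x : x != 0 -> exists chi, normc (ev chi x) = rnorm x.
Proof.
move=> x0; set h := cstar x * x.
have hs : cstar h = h by rewrite cstarMc cstarK mulrC.
have hn : rnorm h = rnorm x ^+ 2 by exact: rnorm_star_mul.
have h0 : h != 0.
  apply: contra x0 => /eqP h0; apply/eqP/rnorm_eq0/eqP.
  by rewrite -(sqrf_eq0 (rnorm x)) -hn h0 rnorm0.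
have [chi chi0] := character_noninvertible (rnorm_not_invertible hs h0).
exists chi; have := chi0 : ev chi _ = 0.
rewrite charB char_scal charM char_star_mul => /eqP.
rewrite subr_eq0 -rmorphM => /eqP/complexI.
rewrite -expr2 hn => /eqP.
by rewrite !eqrXn2 ?sqr_ge0 ?normc_ge0 ?rnorm_ge0 // => /eqP ->.
Qed.

Lemma char_invertibleP x : (forall chi, ev chi x != 0) -> invertible x.
Proof.
move=> xP; apply: contrapT => /character_noninvertible[chi chi0].
by have /eqP := xP chi; apply; exact: chi0.
Qed.

(* [g] is [q / (q + e)] where [q] is the positive part of [p - e]. *)
Lemma cutoff p e : cstar p = p -> 0 < e -> exists g : E, forall chi,
  exists t s, [/\ ev chi p = t%:C, ev chi g = s%:C, t <= e -> s = 0
    & 0 <= t -> t * (1 - s) ^+ 2 <= e].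
Proof.
move=> ps e0; pose c := rnorm (p - scal E e) + 1.
have c0 : 0 < c by rewrite ltr_wpDl ?rnorm_ge0.
(* Dividing by [c] brings [p - e] into the unit ball, where [cabs] is an absolute value. *)
pose k := scal E c^-1 * (p - scal E e).
have k_star : cstar k = k by rewrite cstarMc cstarB !cstar_scal ps.
have k1 : rnorm k <= 1.
  rewrite rnorm_scalM gtr0_norm ?invr_gt0 // ler_pdivrMl // mulr1.
  by rewrite /c lerDl.
pose q := scal E (c / 2) * (cabs k + k).
have chiq chi : exists t, ev chi p = t%:C /\ ev chi q = (Num.max (t - e) 0)%:C.
  have : complex.Im (ev chi p) = 0 by exact: char_real.
  have : complex.Im (ev chi (cabs k)) = 0.
    by apply: char_real; exact: cabs_star.
  have : ev chi (cabs k) * ev chi (cabs k) = ev chi k * ev chi k.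
    by rewrite -!charM cabsK.
  have : normc (1 - ev chi (cabs k)) <= 1.
    by rewrite -(char1 chi) -charB (le_trans (char_le _ _)) ?rnorm_cabs.
  have : ev chi k = c^-1%:C * (ev chi p - e%:C).
    by rewrite charM charB !char_scal.
  have -> : ev chi q = (c / 2)%:C * (ev chi (cabs k) + ev chi k).
    by rewrite charM charD char_scal.
  move=> ->.
  case: (ev chi p) => t t'; case: (ev chi (cabs k)) => a a' /= + + a0 t0.
  rewrite {}a0 {}t0 => a1 aa; exists t; split=> //.
  (* The bound [|1 - a| <= 1] selects the nonnegative root among the two real numbers of square
     [(chi k)^2]. *)
  have {}a1 : 0 <= a.
    rewrite leNgt; apply/negP => a0; move: a1.
    rewrite oppr0 addr0 expr0n addr0 sqrtr_sqr.
    by rewrite leNgt ger0_norm; [rewrite ltrBrDr; lra | lra].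
  have {}aa : a = `|c^-1 * (t - e)|.
    apply/eqP; rewrite -(@eqrXn2 _ 2) // -normrX ger0_norm ?sqr_ge0 //.
    by apply/eqP; move: aa => [+ _]; rewrite !expr2 => aa; lra.
  apply/eqP; rewrite eq_complex /=; apply/andP; split; apply/eqP; last by ring.
  rewrite aa normrM gtr0_norm ?invr_gt0 //.
  have [te|te] := leP (t - e) 0.
    by rewrite ler0_norm //; field; rewrite gt_eqF.
  by rewrite gtr0_norm //; field; rewrite gt_eqF.
have [d dP] : invertible (q + scal E e).
  apply: char_invertibleP => chi; have [t [_ qt]] := chiq chi.
  rewrite charD char_scal qt -rmorphD /= -normc_gt0 normc_real normr_gt0.
  by rewrite gt_eqF // ltr_wpDl // le_max lexx orbT.
exists (q * d) => chi; have [t [pt qt]] := chiq chi.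
have m0 : 0 < Num.max (t - e) 0 + e by rewrite ltr_wpDl // le_max lexx orbT.
exists t, (Num.max (t - e) 0 / (Num.max (t - e) 0 + e)); split=> //.
- have := congr1 (ev chi) dP.
  rewrite charM charD char1 char_scal qt -rmorphD /= => qd.
  rewrite charM qt rmorphM fmorphV; congr (_ * _).
  rewrite -[LHS]mul1r -(@mulVf _ (Num.max (t - e) 0 + e)%:C); last first.
    by rewrite -normc_gt0 normc_real normr_gt0 gt_eqF.
  by rewrite -mulrA qd mulr1.
- by move=> te; rewrite max_r ?mul0r // subr_le0.
move=> t0; have [te|te] := leP t e.
  by rewrite max_r ?subr_le0 // mul0r subr0 expr1n mulr1.
rewrite max_l; last by rewrite subr_ge0 ltW.
rewrite subrK.
have -> : 1 - (t - e) / t = e / t by field; rewrite gt_eqF // (lt_trans e0).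
have t0' : 0 < t by apply: lt_trans te.
have -> : t * (e / t) ^+ 2 = e * (e / t) by field; rewrite gt_eqF.
by rewrite -[leRHS]mulr1 ler_pM2l // ler_pdivrMr // mul1r ltW.
Qed.

End Characters.

(** * Pointwise topology and finite covers *)

Lemma nbhs_ptws (I : eqType) (V : topologicalType) (i : I)
    (g : {ptws I -> V}) (B : set V) :
  nbhs (g i) B -> nbhs g [set f : {ptws I -> V} | B (f i)].
Proof. by move=> /(@proj_continuous _ (fun=> V) i g). Qed.

Lemma open_ptws (I : eqType) (V : topologicalType) (i : I) (B : set V) :
  open B -> open [set f : {ptws I -> V} | B (f i)].
Proof.
move=> oB; rewrite openE => f Bf; apply: nbhs_ptws.
exact: open_nbhs_nbhs.
Qed.

Lemma compact_finite_cover (X : topologicalType) (K : set X) (J : eqType)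
    (f : J -> set X) : compact K -> (forall j, open (f j)) ->
  K `<=` \bigcup_j f j ->
  exists s : seq J, forall x, K x -> exists2 j, j \in s & f j x.
Proof.
move=> /compact_near_coveringP Kc fo Kf.
(* The filter generated by inclusion of finite families turns near-covering compactness into a
   finite subcover. *)
pose F : set_system (seq J) :=
  [set B | exists s0 : seq J, forall s : seq J, {subset s0 <= s} -> B s].
have FF : Filter F.
  split; first by exists [::].
    move=> P Q [s sP] [t tQ]; exists (s ++ t) => u stu; split.
      by apply: sP => j js; apply: stu; rewrite mem_cat js.
    by apply: tQ => j jt; apply: stu; rewrite mem_cat jt orbT.
  by move=> P Q PQ [s sP]; exists s => t /sP/PQ.
have [|s sK] := Kc _ F (fun s x => exists2 j, j \in s & f j x) FF; last first.
  by exists s; exact: sK.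
move=> x /Kf[j _ fjx].
exists (f j, [set s : seq J | j \in s]) => /=.
  split; first exact: open_nbhs_nbhs.
  by exists [:: j] => s; apply; rewrite mem_head.
by move=> [y s] /= [fjy js]; exists j.
Qed.

(** * The spectrum of an ideal *)

Section Spectrum.
Variables (R : realType) (E : comCStarAlgType R) (A : set E).
Hypothesis AI : closed_proper_ideal A.
Implicit Types (x y : E) (a : A) (chi : {lrmorphism E -> R[i]^o}).
Implicit Types (gamma : {ptws A -> R[i]^o}).
Local Notation normc := (@Normc.normc R).

Lemma ideal0 : A 0.
Proof. by case: AI => _ [/set_mem]. Qed.

Lemma idealD x y : A x -> A y -> A (x + y).
Proof.
move=> Ax Ay; case: AI => _ [_ _ AD]; apply: set_mem; rewrite -[x]mul1r.
by apply: AD; exact: mem_set.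
Qed.

Lemma idealM x y : A y -> A (x * y).
Proof.
move=> Ay; case: AI => _ [A0 _ AD]; apply: set_mem; rewrite -[x * y]addr0.
by apply: AD => //; exact: mem_set.
Qed.

Lemma ideal_val a : A (val a).
Proof. exact: set_valP. Qed.

Definition in_ideal x (Ax : A x) : A := SigSub (mem_set Ax).

Definition char_restr chi : {ptws A -> R[i]^o} := fun a => ev chi (val a).

Lemma char_restr_spectrum chi a : ev chi (val a) != 0 ->
  spectrum A (char_restr chi).
Proof.
move=> a0; split; first by exists a.
- by move=> c x y z zE; rewrite /char_restr zE charD charZ.
- by move=> x y z zE; rewrite /char_restr zE charM.
Qed.

Lemma extends_ev chi gamma a : extends chi gamma -> gamma a = ev chi (val a).
Proof. by move=> <-. Qed.

Lemma ext_eval_uniq chi gamma x : spectrum A gamma -> extends chi gamma ->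
  ext_eval gamma x = ev chi x.
Proof.
move=> [[a a0] _ _] chig; rewrite /ext_eval; set S := [set z | _].
have /= [psi psig ->] : S (get S) by apply: getPex; exists (chi x), chi.
have Axa : A (x * val a) by apply: idealM; exact: ideal_val.
apply: (mulIf a0); rewrite {1}(extends_ev _ psig) (extends_ev _ chig).
have := extends_ev (in_ideal Axa) psig; rewrite (extends_ev _ chig) /=.
by rewrite !charM.
Qed.

Section Compactness.
Hypothesis Aext : forall gamma, spectrum A gamma ->
  exists chi : {lrmorphism E -> R[i]^o}, extends chi gamma.

(** These are the compact sets of characters on which the escape hypothesis and the small products
    get used. *)
Definition superlevel a (e : R) : set {ptws A -> R[i]^o} :=
  [set gamma | spectrum A gamma /\ e <= normc (gamma a)].

(** A square instead of a disc, so that compactness comes from a product of two segments. *)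
Definition csquare (r : R) : set R[i]^o :=
  [set z : R[i]^o | `|complex.Re z| <= r /\ `|complex.Im z| <= r].

Lemma compact_csquare r : compact (csquare r).
Proof.
pose f (z : R * R) : R[i]^o := z.1 +i* z.2.
have -> : csquare r = f @` (`[-r, r] `*` `[-r, r]).
  apply/seteqP; split=> [[x y] [/= xr yr]|_ [[x y] /= [xr yr] <-]].
    by exists (x, y) => //; rewrite /= !in_itv /= -!ler_norml.
  by move: xr yr; rewrite !in_itv /= -!ler_norml.
apply: continuous_compact; last by apply: compact_setX; exact: segment_compact.
apply: continuous_subspaceT => -[x y]; apply/cvg_ballP => e /pos_complex[d d0 ->].
have d2 : 0 < d / 2 by rewrite divr_gt0.
exists (ball x (d / 2), ball y (d / 2)) => /=; first by split; exact: nbhsx_ballx.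
move=> [u v] /= [xu yv].
rewrite -ball_normE /= /f /=.
have -> : (x +i* y : R[i]^o) - (u +i* v) = (x - u)%:C + 'i * (y - v)%:C.
  by apply/eqP; rewrite eq_complex /=; apply/andP; split; apply/eqP; ring.
apply: le_lt_trans (ler_normD _ _) _.
rewrite normrM (_ : `|'i%C| = 1 :> R[i]) ?mul1r; last first.
  by rewrite normc_def /= expr0n expr1n add0r sqrtr1.
rewrite [d]splitr !normc_def /= !expr0n !addr0 !sqrtr_sqr -rmorphD ltcR.
exact: ltrD.
Qed.

Lemma csquare_normc (z : R[i]) r : normc z <= r -> csquare r z.
Proof.
move=> zr; have sq := normc_sqr z; have z0 := normc_ge0 z.
have r0 := le_trans z0 zr.
split; rewrite -(@ler_pXn2r _ 2) ?nnegrE // real_normK ?num_real //.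
all: apply: le_trans (_ : normc z ^+ 2 <= _); last by rewrite ler_pXn2r ?nnegrE.
  by rewrite sq lerDl sqr_ge0.
by rewrite sq lerDr sqr_ge0.
Qed.

Lemma ball_normc (z w : R[i]^o) r : ball z r%:C w = (normc (z - w) < r) :> Prop.
Proof.
rewrite -ball_normE /ball_ /= normc_def ltcR.
by case: (z - w).
Qed.

Let ptws_continuous a : continuous (fun gamma => gamma a).
Proof. exact: (@proj_continuous _ (fun=> R[i]^o) a). Qed.

(** Additivity and multiplicativity each relate three values, so approximation at three points
    suffices to pass them to the closure. *)
Lemma closure_ptws (S : set {ptws A -> R[i]^o}) gamma (x y z : A) (d : R) :
  closure S gamma -> 0 < d -> exists g, [/\ S g, normc (gamma x - g x) < d,
    normc (gamma y - g y) < d & normc (gamma z - g z) < d].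
Proof.
move=> Sg d0.
have nx (w : A) : nbhs gamma
    [set g : {ptws A -> R[i]^o} | ball (gamma w) (d%:C : R[i]) (g w)].
  by apply: nbhs_ptws; apply: nbhsx_ballx; rewrite ltcR.
have [g [Sg' [[gx gy] gz]]] := Sg _ (filterI (filterI (nx x) (nx y)) (nx z)).
by exists g; split=> //; [move: gx | move: gy | move: gz]; rewrite /= ball_normc.
Qed.

Lemma normc_small (z : R[i]) (M : R) : 0 <= M ->
  (forall d, 0 < d -> d <= 1 -> normc z <= M * d) -> z = 0.
Proof.
move=> M0 zM; apply: Normc.eq0_normc; apply/eqP.
rewrite eq_le normc_ge0 andbT; apply/ler_addgt0Pr => e e0; rewrite add0r.
have M1 : 0 < M + 1 by rewrite ltr_wpDl.
have d0 : 0 < Num.min 1 (e / (M + 1)) by rewrite lt_min ltr01 divr_gt0.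
apply: le_trans (zM _ d0 _) _; first by rewrite ge_min lexx.
apply: le_trans (_ : (M + 1) * Num.min 1 (e / (M + 1)) <= _).
  by rewrite ler_wpM2r ?(ltW d0) // lerDl.
by rewrite mulrC -ler_pdivlMr // ge_min lexx orbT.
Qed.

Lemma normcB_le (z w : R[i]) : normc (z - w) <= normc z + normc w.
Proof. by rewrite -(normcN w); exact: le_normcD. Qed.

(** The set is closed in a product of squares, compact by Tychonoff, since [|gamma b| <= |b|]. The
    bound [e <= |gamma a|] survives limits and prevents them from being zero. *)
Lemma compact_superlevel a (e : R) : 0 < e -> compact (superlevel a e).
Proof.
move=> e0; apply: (@subclosed_compact _ _
  [set gamma : {ptws A -> R[i]^o} | forall b : A, csquare (rnorm (val b)) (gamma b)]).
- move=> gamma Sg.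
  have ge : e <= normc (gamma a).
    have cB : closed ((fun g : {ptws A -> R[i]^o} => g a) @^-1`
        (~` ball (0 : R[i]^o) e%:C)).
      apply: preimage_closed => [x _|]; first exact: ptws_continuous.
      by apply: open_closedC; apply: ball_open.
    have : (~` ball (0 : R[i]^o) e%:C) (gamma a).
      apply: cB; apply: closure_subset Sg => g [_ ge] /=.
      by rewrite ball_normc sub0r normcN => /lt_le_trans/(_ ge); rewrite ltxx.
    by move=> /=; rewrite ball_normc sub0r normcN => /negP; rewrite -leNgt.
  split=> //; split.
  - by exists a; rewrite -normc_gt0 (lt_le_trans e0).
  - move=> c x y z zE; apply/eqP; rewrite -subr_eq0; apply/eqP.
    apply: (@normc_small _ (normc c + 2)) => [|d d0 _].
      by rewrite addr_ge0 ?normc_ge0.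
    have [g [[[_ lin _] _] gx gy gz]] := closure_ptws x y z Sg d0.
    have -> : gamma z - (c * gamma x + gamma y) = (gamma z - g z) -
        (c * (gamma x - g x) + (gamma y - g y)) :> R[i].
      by rewrite (lin _ _ _ _ zE); ring.
    apply: le_trans (normcB_le _ _) _.
    apply: le_trans (lerD (lexx _) (le_normcD _ _)) _.
    rewrite Normc.normcM; have := ler_wpM2l (normc_ge0 c) (ltW gx); lra.
  - move=> x y z zE; apply/eqP; rewrite -subr_eq0; apply/eqP.
    apply: (@normc_small _ (normc (gamma x) + normc (gamma y) + 2)) => [|d d0 d1].
      by rewrite !addr_ge0 ?normc_ge0.
    have [g [[[_ _ mul] _] gx gy gz]] := closure_ptws x y z Sg d0.
    have -> : gamma z - gamma x * gamma y = (gamma z - g z) -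
        ((gamma x - g x) * gamma y +
         (gamma x - (gamma x - g x)) * (gamma y - g y)) :> R[i].
      by rewrite (mul _ _ _ zE); ring.
    apply: le_trans (normcB_le _ _) _.
    apply: le_trans (lerD (lexx _) (le_normcD _ _)) _.
    rewrite !Normc.normcM.
    have gx1 : normc (gamma x - (gamma x - g x)) <= normc (gamma x) + 1.
      apply: le_trans (normcB_le _ _) _; rewrite lerD2l.
      exact: le_trans (ltW gx) d1.
    have := ler_pM (normc_ge0 _) (normc_ge0 _) gx1 (ltW gy).
    have := ler_wpM2r (normc_ge0 (gamma y)) (ltW gx); lra.
- exact: (tychonoff (fun b => @compact_csquare (rnorm (val b)))).
- move=> gamma [/Aext[chi chig] _] b; apply: csquare_normc.
  by rewrite (extends_ev _ chig) char_le.
Qed.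

(** Finitely many elements of [A] are such that at each point of [K] one of them has modulus above
    1. Summing [cstar x * x] over them excludes cancellation. *)
Lemma compact_bounded_below (K : set {ptws A -> R[i]^o}) :
  K `<=` spectrum A -> compact K ->
  exists a, forall gamma, K gamma -> 1 <= normc (gamma a).
Proof.
(* Values within 1 of 2 have modulus above 1; rescaling reaches the value 2 at any given
   character. *)
move=> KA Kc; pose U (a : A) : set {ptws A -> R[i]^o} :=
  [set g | ball (2 : R[i]^o) (1%:C : R[i]) (g a)].
have [||D DK] := @compact_finite_cover _ K A U Kc.
- by move=> a; apply: open_ptws; exact: ball_open.
- move=> gamma /KA sg; have [[a a0] _ _] := sg; have [chi chig] := Aext sg.
  pose c : R[i] := 2 / (gamma a : R[i]).
  have Ab : A (c *: val a).
    by rewrite -[val a]mul1r scalerAl; apply: idealM; exact: ideal_val.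
  exists (in_ideal Ab) => //=; rewrite /U /= (extends_ev _ chig) /= charZ.
  by rewrite -(extends_ev _ chig) divfK // ball_normc subrr Normc.normc0.
have Dsum : A (\sum_(i <- D) cstar (val i) * val i).
  apply: big_ind => [|x y|i _]; [exact: ideal0 | exact: idealD |].
  by apply: idealM; exact: ideal_val.
exists (in_ideal Dsum) => gamma Kg.
have [chi chig] := Aext (KA _ Kg); rewrite (extends_ev _ chig) /=.
have -> : ev chi (\sum_(i <- D) cstar (val i) * val i) =
    (\sum_(i <- D) normc (ev chi (val i)) ^+ 2)%:C.
  elim/big_ind2 : _ => [|x s y t xs yt|i _]; last exact: char_star_mul.
    by rewrite -[in LHS](subrr (0 : E)) charB subrr.
  by rewrite charD xs yt rmorphD.
rewrite normc_real ger0_norm ?sumr_ge0 // => [|j _]; last by rewrite sqr_ge0.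
have [i Di] := DK _ Kg; rewrite /U /= ball_normc (extends_ev _ chig) => gi.
have gi1 : 1 < normc (ev chi (val i)).
  have := le_normcD (2 - ev chi (val i)) (ev chi (val i)).
  rewrite subrK (_ : normc 2 = 2); first by move: gi; lra.
  by rewrite -[2](rmorph_nat (real_complex R)) normc_real normr_nat.
rewrite (big_rem i) //=; apply: ler_wpDr.
  by apply: sumr_ge0 => j _; rewrite sqr_ge0.
by rewrite expr_ge1 ?normc_ge0 // ltW.
Qed.

End Compactness.
End Spectrum.

(** * Uniform smallness along a sequence *)

Section UniformlySmall.
Variables (R : realType) (T : Type).
Implicit Types (K : set T) (S : set R) (e : R) (f g : nat -> T -> R).

Lemma nnsup_ge0 S : (0 <= nnsup S)%E.
Proof. by apply: ereal_sup_ubound; left. Qed.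

Lemma nnsup_le S e : 0 <= e -> (forall x, S x -> x <= e) ->
  (nnsup S <= e%:E)%E.
Proof.
move=> e0 Se; apply: ge_ereal_sup => _ [->|[x Sx <-]]; first by rewrite lee_fin.
by rewrite lee_fin Se.
Qed.

Lemma le_nnsup S x : S x -> (x%:E <= nnsup S)%E.
Proof. by move=> Sx; apply: ereal_sup_ubound; right; exists x. Qed.

Lemma nnsup_cvg0_le K f (n_ : nat -> nat) e : 0 < e ->
  nnsup [set f (n_ k) x | x in K] @[k --> \oo] --> 0%E ->
  \forall k \near \oo, forall x, K x -> f (n_ k) x <= e.
Proof.
move=> e0 /fine_cvgP[fin /cvgrPdist_lt/(_ _ e0) lim].
near=> k => x Kx; rewrite -lee_fin.
apply: le_trans (@le_nnsup [set f (n_ k) x | x in K] (f (n_ k) x) _) _.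
  by exists x.
have fk : nnsup [set f (n_ k) x | x in K] \is a fin_num by near: k.
rewrite -(fineK fk) lee_fin ltW //.
suff : `|0 - fine (nnsup [set f (n_ k) x | x in K])| < e.
  by rewrite sub0r normrN; apply: le_lt_trans; rewrite ler_norm.
by near: k.
Unshelve. all: by end_near. Qed.

Lemma nnsup_cvg0 K f (n_ : nat -> nat) :
  (forall k x, K x -> f (n_ k) x <= k.+1%:R^-1) ->
  nnsup [set f (n_ k) x | x in K] @[k --> \oo] --> 0%E.
Proof.
move=> fK; apply: (@squeeze_cvge _ _ _ _ (fun=> 0%E) _
  (fun k => (k.+1%:R^-1)%:E)).
- near=> k; rewrite nnsup_ge0 nnsup_le ?invr_ge0 // => _ [x Kx <-].
  exact: fK.
- exact: cvg_cst.
- by apply: cvg_EFin; [near=> k | exact: cvg_harmonic].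
Unshelve. all: by end_near. Qed.

(** Removes sequences and extended reals: both limits along a common sequence amount to simultaneous
    smallness at arbitrarily late indices. *)
Lemma frequently_smallP K f g :
  (forall e N, 0 < e -> exists2 n, (N <= n)%N &
    forall x, K x -> f n x <= e /\ g n x <= e) <->
  exists2 n_ : nat -> nat, {homo n_ : k l / (k < l)%N} &
    (nnsup [set f (n_ k) x | x in K] @[k --> \oo] --> 0%E) /\
    (nnsup [set g (n_ k) x | x in K] @[k --> \oo] --> 0%E).
Proof.
split=> [small|[n_ n_incr [f0 g0]] e N e0].
  have [c cP] : {c : nat * nat -> nat & forall Nk : nat * nat, (Nk.1 <= c Nk)%N /\
      forall x, K x -> f (c Nk) x <= Nk.2.+1%:R^-1 /\ g (c Nk) x <= Nk.2.+1%:R^-1}.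
    apply: (@choice _ _ (fun (Nk : nat * nat) n => (Nk.1 <= n)%N /\
      forall x, K x -> f n x <= Nk.2.+1%:R^-1 /\ g n x <= Nk.2.+1%:R^-1)).
    move=> [N k]; have [|n Nn nP] := small k.+1%:R^-1 N; last by exists n.
    by rewrite invr_gt0.
  (* Each index is taken beyond the previous one, with tolerance [1 / (k + 1)] at stage [k]. *)
  pose n_ := fix n_ k := match k with 0%N => c (0, 0)%N
    | k'.+1 => c ((n_ k').+1, k'.+1) end.
  have n_P k x : K x -> f (n_ k) x <= k.+1%:R^-1 /\ g (n_ k) x <= k.+1%:R^-1.
    case: k => [|k]; first by have [_] := cP (0, 0)%N; exact.
    by have [_] := cP ((n_ k).+1, k.+1); exact.
  exists n_; first by apply: homo_ltn => [? ? ?|k]; [exact: ltn_trans|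
    have [] := cP ((n_ k).+1, k.+1)].
  by split; apply: nnsup_cvg0 => k x /(n_P k)[].
have n_ge k : (k <= n_ k)%N.
  by elim: k => // k IH; apply: leq_ltn_trans IH (n_incr _ _ _).
have [k [Nk [fk gk]]] : exists k, (N <= k)%N /\
    (forall x, K x -> f (n_ k) x <= e) /\ forall x, K x -> g (n_ k) x <= e.
  near \oo => k; exists k; split; first by near: k; exists N.
  by split; near: k; exact: nnsup_cvg0_le.
exists (n_ k); first exact: leq_trans (n_ge k).
by move=> x Kx; split; [exact: fk | exact: gk].
Unshelve. all: by end_near. Qed.

End UniformlySmall.

(** * Powers of the isomorphism and characters *)

Section StarIsomorphism.
Variables (R : realType) (E : comCStarAlgType R).
Implicit Types (chi : {lrmorphism E -> R[i]^o}) (x y : E).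

Lemma character_comp (f : {lrmorphism E -> E}) chi n :
  exists psi : {lrmorphism E -> R[i]^o},
    forall x, ev psi x = ev chi (iter n f x).
Proof.
elim: n => [|n [psi psiP]]; first by exists chi.
by exists (psi \o f : {lrmorphism E -> R[i]^o}) => x; rewrite iterSr -psiP.
Qed.

Variable Phi : isometricStarIso E.

Lemma siso_inv_linear : linear (siso_inv Phi).
Proof.
move=> c x y; apply: (can_inj (sisoK Phi)).
by rewrite linearP /= !siso_invK.
Qed.

Lemma siso_inv_monoid : monoid_morphism (siso_inv Phi).
Proof.
split=> [|x y]; apply: (can_inj (sisoK Phi)).
  by rewrite siso_invK rmorph1.
by rewrite rmorphM /= !siso_invK.
Qed.

Definition siso_inv_lrmorphism : {lrmorphism E -> E} :=
  HB.pack (siso_inv Phi)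
    (GRing.isLinear.Build _ _ _ _ (siso_inv Phi) siso_inv_linear)
    (GRing.isMonoidMorphism.Build _ _ (siso_inv Phi) siso_inv_monoid).

Lemma iter_sisoK n : cancel (iter n Phi) (iter n (siso_inv Phi)).
Proof. by elim: n => // n IH x; rewrite iterSr iterS sisoK IH. Qed.

Lemma iter_siso_invK n : cancel (iter n (siso_inv Phi)) (iter n Phi).
Proof. by elim: n => // n IH x; rewrite iterSr iterS siso_invK IH. Qed.

Lemma iter_siso_pow j n x : (j <= n)%N ->
  iter n Phi (siso_pow Phi (j%:Z - n%:Z) x) = iter j Phi x.
Proof.
move=> /subnKC <-; set k := (n - j)%N.
have -> : (j%:Z - (j + k)%:Z)%R = - k%:Z by rewrite PoszD opprD addNKr.
rewrite iterD; congr iter; case: k => [//|k].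
exact: (iter_siso_invK k.+1).
Qed.

End StarIsomorphism.

(** * Density in terms of the norm *)

Section SubsetDensity.
Variables (R : realType) (E : comCStarAlgType R) (A : set E).

Lemma dense_rnormP (S : set A) : dense S <->
  forall (a : A) (e : R), 0 < e -> exists2 s, S s & rnorm (val s - val a) < e.
Proof.
split=> [dS a e e0|dS O [a Oa] [U oU UO]].
  have [||s [/= sa Ss]] := dS ((val : A -> E) @^-1` ball (val a) (e%:C : R[i])).
  - by exists a; rewrite /= ball_rnorm // subrr rnorm0.
  - apply: open_comp => [x _|]; last exact: ball_open.
    exact: (@initial_continuous _ _ (val : A -> E) x).
  - by exists s => //; move: sa; rewrite ball_rnorm // rnormB.
have : nbhs (val a) U by apply: open_nbhs_nbhs; split=> //; move: Oa; rewrite -UO.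
move=> /nbhs_ballP[e /pos_complex[r r0 ->] aU].
have [s Ss sa] := dS a r r0; exists s; split=> //; rewrite -UO.
by apply: aU; rewrite ball_rnorm // rnormB.
Qed.

End SubsetDensity.

(** * The weighted operator *)

Section Dynamics.
Variables (R : realType) (E : comCStarAlgType R) (A : set E).
Variables (AI : closed_proper_ideal A) (Phi : isometricStarIso E).
Variables (PhiA : Phi @` A = A) (b : E).
Implicit Types (a u v w x y z : A) (chi psi : {lrmorphism E -> R[i]^o}).
Implicit Types (gamma : {ptws A -> R[i]^o}) (n N k : nat) (e d : R).
Local Notation normc := (@Normc.normc R).
Local Notation U := (U_op AI PhiA b).

Lemma val_U a : val (U a) = b * Phi (val a).
Proof. by []. Qed.

Lemma val_iter_restr n a :
  val (iter n (restr (image_eq_fun PhiA)) a) = iter n Phi (val a).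
Proof. by elim: n => //= n ->. Qed.

Definition weight chi n := \prod_(0 <= j < n) normc (ev chi (iter j Phi b)).

(** The equality of [psi] with [chi o Phi^n] on [E], kept as a relation so that either character can
    be the given one. *)
Definition comp_pow n chi psi := forall x : E, ev psi x = ev chi (iter n Phi x).

Lemma comp_pow_exists n chi : exists psi, comp_pow n chi psi.
Proof. exact: (character_comp Phi). Qed.

Lemma comp_pow_inv n psi : exists chi, comp_pow n chi psi.
Proof.
have [chi chiP] := character_comp (siso_inv_lrmorphism Phi) psi n.
exists chi => x; rewrite chiP; congr ev.
by rewrite [LHS](esym (iter_sisoK Phi n x)).
Qed.

Lemma normc_iter_U n chi psi a : comp_pow n chi psi ->
  normc (ev chi (val (iter n U a))) = weight chi n * normc (ev psi (val a)).
Proof.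
elim: n chi => [|n IH] chi psiP; first by rewrite /weight big_geq // mul1r psiP.
have [phi phiP] := comp_pow_exists 1 chi.
rewrite iterS val_U charM Normc.normcM -phiP IH => [|x]; last first.
  by rewrite psiP iterS phiP.
rewrite mulrA /weight big_nat_recl //; congr (_ * _ * _).
by apply: eq_bigr => j _; rewrite phiP.
Qed.

Lemma prod_ext_eval_inv n chi gamma : spectrum A gamma -> extends chi gamma ->
  \prod_(0 <= j < n) (normc (ext_eval gamma (siso_pow Phi j%:Z b)))^-1 =
  (weight chi n)^-1.
Proof.
move=> sg chig; rewrite -prodfV; apply: eq_bigr => j _.
by rewrite (ext_eval_uniq AI _ sg chig).
Qed.

(** Here [gamma] extends to [chi o Phi^n], so its value at [Phi^(j - n) b] is [chi (Phi^j b)]. *)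
Lemma prod_ext_eval n chi psi gamma : comp_pow n chi psi ->
  spectrum A gamma -> extends psi gamma ->
  \prod_(0 <= j < n) normc (ext_eval gamma (siso_pow Phi (j%:Z - n%:Z) b)) =
  weight chi n.
Proof.
move=> psiP sg psig; apply: eq_big_nat => j /andP[_ jn].
by rewrite (ext_eval_uniq AI _ sg psig) psiP iter_siso_pow // ltnW.
Qed.

(** Condition (2) for a single [K], in the form given by [frequently_smallP]. *)
Definition small_products (K : set {ptws A -> R[i]^o}) := forall e N, 0 < e ->
  exists2 n, (N <= n)%N & forall gamma, K gamma ->
    \prod_(0 <= j < n)
      normc (ext_eval gamma (siso_pow Phi (j%:Z - n%:Z) b)) <= e /\
    \prod_(0 <= j < n) (normc (ext_eval gamma (siso_pow Phi j%:Z b)))^-1 <= e.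

(** * Hypercyclicity implies small products *)

Section Hypercyclic.
Hypotheses (Ainf : infinite_dimensional A).
Hypothesis Aext : forall gamma, spectrum A gamma ->
  exists chi : {lrmorphism E -> R[i]^o}, extends chi gamma.
Hypothesis Phi_escape : forall K : set {ptws A -> R[i]^o},
  K `<=` spectrum A -> compact K ->
  exists2 N : nat, (0 < N)%N &
    [set (gamma \o iter n (restr (image_eq_fun PhiA)) : {ptws A -> R[i]^o})
       | gamma in K & n in [set n | (N <= n)%N]] `&` K = set0.

(** For [n >= N], [chi] and [chi o Phi^n] cannot both lie in the compact set where
    [|gamma a| >= e]. *)
Lemma escape_superlevel a e : 0 < e -> exists N, forall n chi psi,
  (N <= n)%N -> comp_pow n chi psi ->
  e <= normc (ev chi (val a)) -> normc (ev psi (val a)) < e.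
Proof.
move=> e0; have KA : superlevel a e `<=` spectrum A by move=> ? [].
have in_superlevel chi : e <= normc (ev chi (val a)) ->
    superlevel a e (char_restr chi).
  move=> ea; split=> //; apply: (@char_restr_spectrum _ _ _ _ a).
  by rewrite -normc_gt0 (lt_le_trans e0).
have [N _ NP] := Phi_escape KA (compact_superlevel (a := a) Aext e0).
exists N => n chi psi Nn psiP chia; rewrite ltNge; apply/negP => psia.
have : (set0 : set {ptws A -> R[i]^o}) (char_restr psi); last by [].
rewrite -NP; split; last exact: in_superlevel.
exists (char_restr chi); first exact: in_superlevel.
exists n => //; apply/funext => x.
by rewrite /= /char_restr val_iter_restr psiP.
Qed.

(* [A] has no isolated points, so a dense orbit returns to every ball. *)
Lemma dense_orbit_recurrent x : dense (range (fun n => iter n U x)) ->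
  forall N a e, 0 < e -> exists2 n, (N <= n)%N &
    rnorm (val (iter n U x) - val a) < e.
Proof.
move=> /dense_rnormP dx; elim=> [|N IH] a e e0.
  by have [_ [n _ <-] na] := dx a e e0; exists n.
(* A radius at most the distance from [c] to the [N]-th orbit point excludes the index [N]. *)
have avoid (c : A) d : 0 < d -> iter N U x != c ->
    exists2 n, (N < n)%N & rnorm (val (iter n U x) - val c) < d.
  move=> d0 xc; have r0 : 0 < rnorm (val (iter N U x) - val c).
    rewrite lt_def rnorm_ge0 andbT; apply: contra xc => /eqP/rnorm_eq0/eqP.
    by rewrite subr_eq0 => /eqP/val_inj ->.
  have [|n Nn] := IH c (Num.min d (rnorm (val (iter N U x) - val c))).
    by rewrite lt_min d0.
  rewrite lt_min => /andP[nd nN]; exists n => //.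
  by rewrite ltn_neqAle Nn andbT; apply/eqP => Nn'; move: nN; rewrite Nn' ltxx.
have [xa|xa] := eqVneq (iter N U x) a; last exact: avoid.
(* Lying outside the span of the empty family means being nonzero. *)
have [t t0] := Ainf (fun i : 'I_0 => a).
have {}t0 : val t != 0.
  by have := t0 (fun _ => 0); rewrite big_ord0.
have rt : 0 < rnorm (val t).
  by rewrite lt_def rnorm_ge0 andbT; apply: contra t0 => /eqP/rnorm_eq0 ->.
(* If [a] is itself the [N]-th orbit point, aim instead at a point at distance [e / 2] from it. *)
pose s := e / 2 / rnorm (val t); have s0 : 0 < s by rewrite !divr_gt0.
have Ac : A (val a + scal E s * val t).
  by apply: idealD => //; [|apply: idealM => //]; exact: ideal_val.
have st : rnorm (scal E s * val t) = e / 2.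
  by rewrite rnorm_scalM gtr0_norm // divfK // gt_eqF.
have [||n Nn nc] := avoid (in_ideal Ac) (e / 2).
- by rewrite divr_gt0.
- rewrite xa; apply/eqP => /(congr1 val)/= ac.
  have : rnorm (scal E s * val t) = 0.
    rewrite -(rnorm0 E); congr rnorm.
    by apply: (@addrI _ (val a)); rewrite -ac addr0.
  by rewrite st => /eqP; rewrite gt_eqF // divr_gt0.
exists n => //; apply: le_lt_trans (ler_rnormB (val (in_ideal Ac)) _ _) _.
by rewrite [e]splitr ltr_leD //= addrC addKr st.
Qed.

Lemma hypercyclic_small_products (K : set {ptws A -> R[i]^o}) :
  hypercyclic U -> K `<=` spectrum A -> compact K -> small_products K.
Proof.
move=> [x dx] KA Kc e N e0.
have [a aK] := compact_bounded_below AI Aext KA Kc.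
(* With [d <= 1/2], values at points of [K] stay above [1/2]; with [4 d <= e], the quotient of [2 d]
   by [1/2] is at most [e]. *)
pose d := Num.min 2^-1 (e / 4).
have d0 : 0 < d by rewrite lt_min invr_gt0 ltr0n divr_gt0.
have d2 : d <= 2^-1 by rewrite ge_min lexx.
have de : 4 * d <= e by rewrite mulrC -ler_pdivlMr // ge_min lexx orbT.
have [M MP] := escape_superlevel a d0.
have [m _ va] := dense_orbit_recurrent dx 0 a d0.
have [k kM ka] := dense_orbit_recurrent dx (m + maxn N M) a d0.
pose v := iter m U x; pose n := (k - m)%N.
have mk : (m <= k)%N by apply: leq_trans kM; exact: leq_addr.
have nNM : (maxn N M <= n)%N by rewrite leq_subRL.
have {}ka : rnorm (val (iter n U v) - val a) < d by rewrite -iterD subnK.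
have close chi (y : A) : rnorm (val y - val a) < d ->
    normc (ev chi (val y) - ev chi (val a)) < d.
  by rewrite -charB; apply: le_lt_trans; exact: char_le.
have upper chi (y : A) : rnorm (val y - val a) < d ->
    normc (ev chi (val a)) < d -> normc (ev chi (val y)) <= 2 * d.
  move=> /(close chi) cy ca.
  have := le_normcD (ev chi (val y) - ev chi (val a)) (ev chi (val a)).
  by rewrite subrK; lra.
have lower chi (y : A) : rnorm (val y - val a) < d ->
    1 <= normc (ev chi (val a)) -> 2^-1 <= normc (ev chi (val y)).
  move=> /(close chi) cy ca.
  have := normcB_le (ev chi (val y)) (ev chi (val y) - ev chi (val a)).
  by rewrite subKr; lra.
exists n; first by apply: leq_trans nNM; exact: leq_maxl.
move=> gamma Kg; have sg := KA _ Kg; have [chi chig] := Aext sg.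
have Mn : (M <= n)%N by apply: leq_trans nNM; exact: leq_maxr.
have chia : 1 <= normc (ev chi (val a)) by rewrite -(extends_ev _ chig) aK.
have dchia : d <= normc (ev chi (val a)) by lra.
split.
  have [phi phiP] := comp_pow_inv n chi.
  rewrite (prod_ext_eval phiP sg chig).
  (* Escape read backwards: a large value at [phi = chi o Phi^-n] would force a small one at
     [chi]. *)
  have phia : normc (ev phi (val a)) < d.
    rewrite ltNge; apply/negP => dphi.
    by have := MP _ _ _ Mn phiP dphi; rewrite ltNge dchia.
  have := upper _ _ ka phia; rewrite (normc_iter_U _ phiP).
  have := lower _ _ va chia.
  have : 0 <= weight phi n by apply: prodr_ge0 => j _; exact: normc_ge0.
  rewrite -/v; nra.
have [psi psiP] := comp_pow_exists n chi.
rewrite (prod_ext_eval_inv _ sg chig).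
have := upper _ _ va (MP _ _ _ Mn psiP dchia).
have := lower _ _ ka chia; rewrite (normc_iter_U _ psiP) -/v.
set W := weight chi n; set r := normc _ => Wr r2.
have W0 : 0 <= W by apply: prodr_ge0 => j _; exact: normc_ge0.
(* From [1/2 <= W r], [r <= 2 d] and [4 d <= e]. *)
have W1 : 1 <= e * W by have r0 : 0 <= r := normc_ge0 _; nra.
have Wp : 0 < W.
  by rewrite lt_def W0 andbT; apply/eqP => W00; move: W1; rewrite W00; lra.
by rewrite -[_^-1]mul1r ler_pdivrMr.
Qed.

End Hypercyclic.

(** * Small products imply a dense orbit *)

Hypothesis b_unit : exists c : E, b * c = 1.

Lemma weight_gt0 chi n : 0 < weight chi n.
Proof.
apply: prodr_gt0 => j _; rewrite normc_gt0.
have [psi psiP] := comp_pow_exists j chi.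
by rewrite -psiP; exact: char_invertible.
Qed.

(** Supplies the element written [U^-n w], without constructing an inverse operator on [A]. *)
Lemma U_onto n w : exists z, iter n U z = w.
Proof.
elim: n w => [|n IH] w; first by exists w.
have [c bc] := b_unit.
have : A (c * val w) by apply: idealM => //; exact: ideal_val.
rewrite -{1}PhiA => -[y Ay yE].
have [z zE] := IH (in_ideal Ay); exists z.
by rewrite iterS zE; apply: val_inj; rewrite val_U /= yE mulrA bc mul1r.
Qed.

Lemma iter_UD n u v w : val u = val v + val w ->
  val (iter n U u) = val (iter n U v) + val (iter n U w).
Proof.
move=> uE; elim: n => // n IH.
by rewrite !iterS !val_U IH rmorphD mulrDr.
Qed.

Lemma iter_U_lipschitz n u v :
  rnorm (val (iter n U u) - val (iter n U v)) <=
  rnorm b ^+ n * rnorm (val u - val v).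
Proof.
elim: n => [|n IH]; first by rewrite mul1r.
rewrite !iterS !val_U -mulrBr -rmorphB; apply: le_trans (ler_rnormM _ _) _.
rewrite exprS -mulrA ler_wpM2l ?rnorm_ge0 //.
by rewrite {1}/rnorm siso_isometry.
Qed.

(** Some character attains the norm of a nonzero [y]. Restricting to characters with [chi y != 0]
    lets support information be used. *)
Lemma rnorm_le_char (y : E) e : 0 <= e ->
  (forall chi, ev chi y != 0 -> normc (ev chi y) <= e) -> rnorm y <= e.
Proof.
move=> e0 ye; have [->|y0] := eqVneq y 0; first by rewrite rnorm0.
have [chi chiy] := char_norming y0; rewrite -chiy; apply: ye.
rewrite -normc_gt0 chiy lt_def rnorm_ge0 andbT.
by apply: contra y0 => /eqP/rnorm_eq0 ->.
Qed.

Section Transitive.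
Hypothesis Aext : forall gamma, spectrum A gamma ->
  exists chi : {lrmorphism E -> R[i]^o}, extends chi gamma.
Hypothesis small : forall K : set {ptws A -> R[i]^o},
  K `<=` spectrum A -> compact K -> small_products K.

Lemma small_products_transitive u w e : 0 < e -> exists v n,
  rnorm (val v - val u) < e /\ rnorm (val (iter n U v) - val w) < e.
Proof.
move=> e0; have e2 : 0 < e / 2 by rewrite divr_gt0.
(* At each character [p] dominates [|chi u|^2] and [|chi w|^2], so one cutoff serves both
   elements. *)
pose p := cstar (val u) * val u + cstar (val w) * val w.
have Ap : A p by apply: idealD => //; apply: idealM => //; exact: ideal_val.
have ps : cstar p = p.
  by rewrite cstarD !cstarMc !cstarK; congr (_ + _); rewrite mulrC.
have d0 : 0 < (e / 2) ^+ 2 by rewrite exprn_gt0.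
have [g gP] := cutoff ps d0.
have pE chi : ev chi p =
    (normc (ev chi (val u)) ^+ 2 + normc (ev chi (val w)) ^+ 2)%:C.
  by rewrite charD !char_star_mul rmorphD.
have approx (y : A) : (forall chi, normc (ev chi (val y)) ^+ 2 <=
      normc (ev chi (val u)) ^+ 2 + normc (ev chi (val w)) ^+ 2) ->
    rnorm (g * val y - val y) <= e / 2.
  move=> yp; apply: rnorm_le_char; first exact: ltW.
  move=> chi _; have [t [s [pt gs _ ts]]] := gP chi.
  have tE : normc (ev chi (val u)) ^+ 2 + normc (ev chi (val w)) ^+ 2 = t.
    by apply: complexI; rewrite -pE.
  have y2 := yp chi; rewrite tE in y2.
  rewrite charB charM gs -(@ler_pXn2r _ 2) ?nnegrE ?normc_ge0 ?(ltW e2) //.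
  have -> : s%:C * ev chi (val y) - ev chi (val y) =
    - ((1 - s)%:C * ev chi (val y)) by rewrite rmorphB rmorph1; ring.
  rewrite normcN Normc.normcM normc_real exprMn real_normK ?num_real //.
  apply: le_trans (ts _); last by apply: le_trans y2; rewrite sqr_ge0.
  by rewrite mulrC ler_wpM2r ?sqr_ge0.
(* Characters outside this compact set kill every multiple of [g]. *)
pose K := superlevel (in_ideal Ap) ((e / 2) ^+ 2).
have K_supp chi (y : A) : ev chi (g * val y) != 0 -> K (char_restr chi).
  have [t [s [pt gs ts _]]] := gP chi.
  rewrite charM mulf_eq0 negb_or gs => /andP[s0 _].
  have et : (e / 2) ^+ 2 < t.
    by rewrite ltNge; apply: contra s0 => /ts ->.
  have nt : normc (ev chi p) = t.
    by rewrite pt normc_real gtr0_norm // (lt_trans d0).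
  split; last by rewrite /char_restr /= nt ltW.
  apply: (@char_restr_spectrum _ _ _ _ (in_ideal Ap)).
  by rewrite -normc_gt0 /= nt (lt_trans d0).
have Au : A (g * val u) by apply: idealM => //; exact: ideal_val.
have Aw : A (g * val w) by apply: idealM => //; exact: ideal_val.
pose M := rnorm (g * val u) + rnorm (g * val w) + 1.
have M0 : 0 < M by rewrite ltr_wpDl // addr_ge0 ?rnorm_ge0.
have h0 : 0 < e / 2 / M by rewrite divr_gt0.
have hM (r : R) : 0 <= r -> r <= rnorm (g * val u) + rnorm (g * val w) ->
    e / 2 / M * r < e / 2.
  by move=> r0 rM; rewrite mulrAC ltr_pdivrMr // ltr_pM2l // /M; lra.
have KA : K `<=` spectrum A by move=> ? [].
have [n _ nP] := small KA (compact_superlevel Aext d0) 0 h0.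
have [z zE] := U_onto n (in_ideal Aw).
(* If [chi] does not kill [U^n (g u)], then [chi o Phi^n] lies in [K], and the first product bounds
   the weight of [chi]. *)
have Uu : rnorm (val (iter n U (in_ideal Au))) < e / 2.
  apply: le_lt_trans (hM _ (rnorm_ge0 (g * val u)) _); last first.
    by rewrite lerDl rnorm_ge0.
  apply: rnorm_le_char => [|chi]; first by rewrite mulr_ge0 ?rnorm_ge0 // ltW.
  rewrite -normc_gt0; have [psi psiP] := comp_pow_exists n chi.
  rewrite (normc_iter_U _ psiP) pmulr_rgt0 ?weight_gt0 // normc_gt0 => psiu.
  have Kpsi := K_supp _ _ psiu; have [+ _] := nP _ Kpsi.
  rewrite (prod_ext_eval psiP (KA _ Kpsi)) // => Wh.
  by apply: ler_pM => //; rewrite ?normc_ge0 ?char_le ?ltW ?weight_gt0.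
(* If [psi = chi o Phi^n] does not kill [z], then [chi] does not kill [g w] and lies in [K]; the
   second product bounds the inverse weight. *)
have zn : rnorm (val z) < e / 2.
  apply: le_lt_trans (hM _ (rnorm_ge0 (g * val w)) _); last first.
    by rewrite lerDr rnorm_ge0.
  apply: rnorm_le_char => [|psi]; first by rewrite mulr_ge0 ?rnorm_ge0 // ltW.
  rewrite -normc_gt0 => psiz; have [chi psiP] := comp_pow_inv n psi.
  have W0 := weight_gt0 chi n.
  have := normc_iter_U z psiP; rewrite zE /= => chiw.
  have chiw0 : ev chi (g * val w) != 0 by rewrite -normc_gt0 chiw mulr_gt0.
  have Kchi := K_supp _ _ chiw0; have [_] := nP _ Kchi.
  rewrite (@prod_ext_eval_inv _ chi _ (KA _ Kchi)) // => Wh.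
  have -> : normc (ev psi (val z)) = (weight chi n)^-1 * normc (ev chi (g * val w)).
    by rewrite chiw mulKf // gt_eqF.
  by apply: ler_pM => //; rewrite ?invr_ge0 ?normc_ge0 ?char_le ?ltW.
have Av : A (g * val u + val z) by apply: idealD => //; exact: ideal_val.
exists (in_ideal Av), n; split.
  have -> : g * val u + val z - val u = (g * val u - val u) + val z by ring.
  apply: le_lt_trans (ler_rnormD _ _) _; rewrite [e]splitr.
  apply: ler_ltD zn; apply: approx => chi.
  by rewrite lerDl sqr_ge0.
rewrite (@iter_UD n _ (in_ideal Au) z) // zE /= -addrA addrC.
apply: le_lt_trans (ler_rnormD _ _) _; rewrite [e]splitr.
apply: ler_ltD Uu; apply: approx => chi.
by rewrite lerDr sqr_ge0.
Qed.

(** One shrinking step: the closed ball at [y] lies in the ball of radius [d] at [x], and the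
    Lipschitz constant [|b|^n] makes the estimate at [y] hold on all of it. *)
Lemma transitive_step x w d e : 0 < d -> 0 < e -> exists y r,
  [/\ 0 < r, r <= d / 2, rnorm (val y - val x) < d / 2 & exists n, forall v,
    rnorm (val v - val y) <= r -> rnorm (val (iter n U v) - val w) < e].
Proof.
move=> d0 e0; have e2 : 0 < e / 2 by rewrite divr_gt0.
have d2 : 0 < d / 2 by rewrite divr_gt0.
have [|y [n [yx yw]]] := @small_products_transitive x w (Num.min (d / 2) (e / 2)).
  by rewrite lt_min d2.
have B0 : 0 < rnorm b ^+ n + 1 by rewrite ltr_wpDl // exprn_ge0 ?rnorm_ge0.
exists y, (Num.min (d / 2) (e / 2 / (rnorm b ^+ n + 1))); split.
- by rewrite lt_min d2 divr_gt0.
- by rewrite ge_min lexx.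
- by move: yx; rewrite lt_min => /andP[].
exists n => v; rewrite le_min => /andP[_ vy].
apply: le_lt_trans (ler_rnormB (val (iter n U y)) _ _) _; rewrite [e]splitr.
apply: ler_ltD; last by move: yw; rewrite lt_min => /andP[].
apply: le_trans (iter_U_lipschitz _ _ _) _.
apply: le_trans (_ : (rnorm b ^+ n + 1) * rnorm (val v - val y) <= _).
  by rewrite ler_wpM2r ?rnorm_ge0 // lerDl.
by rewrite mulrC -ler_pdivlMr.
Qed.

(* Baire's argument by nested balls: the [k]-th ball forces some iterate of
   its points into the [k]-th neighbourhood of a countable base, the pairs
   (point, radius) being coded by [pickle]. *)
Lemma small_products_hypercyclic : separable A -> hypercyclic U.
Proof.
move=> [D /countable_injP[f f_inj] /dense_rnormP Ddense].
pose a0 : A := in_ideal (ideal0 AI).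
(* Enumerates [D] by its injection into [nat]; indices outside the image get the default [a0]. *)
pose pt i : A := xget a0 [set x | D x /\ f x = i].
pose code k : nat * nat := odflt (0, 0)%N (unpickle k).
pose rad k : R := 2 / (code k).2.+2%:R.
have rad0 k : 0 < rad k by rewrite divr_gt0.
pose step k (s t : A * R) := 0 < s.2 -> [/\ 0 < t.2, t.2 <= s.2 / 2,
  rnorm (val t.1 - val s.1) < s.2 / 2 & exists n, forall v,
    rnorm (val v - val t.1) <= t.2 ->
    rnorm (val (iter n U v) - val (pt (code k).1)) < rad k].
have [F FP] : {F : nat * (A * R) -> A * R & forall ks, step ks.1 ks.2 (F ks)}.
  (* A nonpositive radius makes [step] vacuous, so the choice function is total; the radii reached
     from 1 remain positive. *)
  apply: (@choice _ _ (fun ks => step ks.1 ks.2)) => -[k [x d]] /=.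
  have [d0|d0] := ltP 0 d; last first.
    by exists (x, d); rewrite /step /= ltNge d0.
  have [y [r [r0 rd yx yn]]] := transitive_step x (pt (code k).1) d0 (rad0 k).
  by exists (y, r) => _; split.
pose s := fix s k := match k with 0%N => (a0, 1) | k'.+1 => F (k', s k') end.
have s0 k : 0 < (s k).2.
  by elim: k => //= k IH; have [] := FP (k, s k) IH.
have sS k : [/\ (s k.+1).2 <= (s k).2 / 2,
    rnorm (val (s k.+1).1 - val (s k).1) < (s k).2 / 2 & exists n, forall v,
    rnorm (val v - val (s k.+1).1) <= (s k.+1).2 ->
    rnorm (val (iter n U v) - val (pt (code k).1)) < rad k].
  by have [] := FP (k, s k) (s0 k).
have dist k m : (k <= m)%N ->
    rnorm (val (s m).1 - val (s k).1) <= (s k).2 - (s m).2.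
  move=> /subnK <-; elim: (m - k)%N => [|i IH]; first by rewrite !subrr rnorm0.
  apply: le_trans (ler_rnormB (val (s (i + k)%N).1) _ _) _.
  have [h1 h2 _] := sS (i + k)%N; rewrite addSn; lra.
(* A rate weaker than the actual halving, of the form that [rate_small] handles. *)
have s_rate k : (s k).2 <= 2 / k.+2%:R.
  elim: k => [|k IH]; first by rewrite divff.
  have [h _ _] := sS k; apply: le_trans h _.
  apply: le_trans (ler_wpM2r _ IH) _; first by rewrite invr_ge0.
  rewrite mulrAC divff // mul1r ler_pdivlMr // mulrC ler_pdivrMr //.
  by rewrite -natrM ler_nat mul2n -addnn -[k.+3]addn1 leq_add2l.
have dist_rate k m : (k <= m)%N ->
    rnorm (val (s m).1 - val (s k).1) <= (s k).2.
  by move=> /dist/le_trans; apply; rewrite gerBl ltW.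
have [l sl] : exists l, tends (fun k => val (s k).1) l.
  apply: cauchy_tends => e e0.
  have [N NP] := @rate_small R (e / 2) (divr_gt0 e0 (ltr0Sn _ 1)).
  have close m : (N <= m)%N -> rnorm (val (s m).1 - val (s N).1) < e / 2.
    move=> /dist_rate/le_lt_trans; apply; exact: le_lt_trans (s_rate N) NP.
  exists N => m n Nm Nn; apply: le_lt_trans (ler_rnormB (val (s N).1) _ _) _.
  by rewrite [e]splitr (rnormB (val (s N).1)) ltrD ?close.
have Al : A l.
  by apply: closed_tends sl => [|k]; [case: AI | exact: ideal_val].
have ls k : rnorm (l - val (s k).1) <= (s k).2.
  rewrite rnormB; apply: le_rnorm_tends sl _; exists k => m km.
  by rewrite rnormB dist_rate.
exists (in_ideal Al); apply/dense_rnormP => a e e0.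
have e2 : 0 < e / 2 by rewrite divr_gt0.
have [x Dx xa] := Ddense a (e / 2) e2.
have [j je] := rate_small e2.
(* Stage [k] targets the point [x] at radius [2 / (j + 2)], and [l] lies in the closed ball produced
   there. *)
pose k : nat := pickle (f x, j).
have kE : code k = (f x, j) by rewrite /code pickleK.
have ptE : pt (f x) = x.
  have [Dp fp] : D (pt (f x)) /\ f (pt (f x)) = f x.
    exact: (@xgetI _ a0 [set y | D y /\ f y = f x] x).
  by apply: f_inj; rewrite ?inE.
have [_ _ [n nP]] := sS k.
exists (iter n U (in_ideal Al)); first by exists n.
apply: le_lt_trans (ler_rnormB (val x) _ _) _; rewrite [e]splitr ltrD //.
have := nP (in_ideal Al) (ls k.+1); rewrite /rad kE /= ptE.
by move=> /lt_trans; apply.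
Qed.

End Transitive.
End Dynamics.

Theorem theorem2p7 (R : realType) (E : comCStarAlgType R) (A : set E)
    (AI : closed_proper_ideal A)
    (Asep : separable A) (Ainf : infinite_dimensional A)
    (Aext : forall gamma, spectrum A gamma ->
      exists chi : {lrmorphism E -> R[i]^o}, extends chi gamma)
    (Phi : isometricStarIso E) (PhiA : Phi @` A = A)
    (b : E) (b_unit : exists c : E, b * c = 1)
    (Phi_escape : forall K : set {ptws A -> R[i]^o},
      K `<=` spectrum A -> compact K ->
      exists2 N : nat, (0 < N)%N &
        [set (gamma \o iter n (restr (image_eq_fun PhiA)) : {ptws A -> R[i]^o})
           | gamma in K & n in [set n | (N <= n)%N]] `&` K = set0) :
  hypercyclic (U_op AI PhiA b) <->
  (forall K : set {ptws A -> R[i]^o}, K `<=` spectrum A -> compact K ->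
    exists2 n_ : nat -> nat, {homo n_ : k l / (k < l)%N} &
      (nnsup [set \prod_(0 <= j < n_ k)
                Normc.normc (ext_eval gamma (siso_pow Phi (j%:Z - (n_ k)%:Z) b))
              | gamma in K] @[k --> \oo] --> 0%E) /\
      (nnsup [set \prod_(0 <= j < n_ k)
                (Normc.normc (ext_eval gamma (siso_pow Phi j%:Z b)))^-1
              | gamma in K] @[k --> \oo] --> 0%E)).
Proof.
pose P n (gamma : {ptws A -> R[i]^o}) := \prod_(0 <= j < n)
  Normc.normc (ext_eval gamma (siso_pow Phi (j%:Z - n%:Z) b)).
pose Q n (gamma : {ptws A -> R[i]^o}) := \prod_(0 <= j < n)
  (Normc.normc (ext_eval gamma (siso_pow Phi j%:Z b)))^-1.
split=> [Uh K KA Kc|Usmall].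
  apply: (iffLR (frequently_smallP K P Q)).
  exact: (hypercyclic_small_products Ainf Aext Phi_escape Uh KA Kc).
apply: (small_products_hypercyclic AI PhiA b_unit Aext _ Asep) => K KA Kc.
exact: (iffRL (frequently_smallP K P Q) (Usmall K KA Kc)).
Qed.
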